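(* Let $b:\Omega\to\mathbb C$ be holomorphic, and define, for $x\in\Omega$, $$T_b(x)=\begin{pmatrix}1&0\\ b(x)&1\end{pmatrix}x\begin{pmatrix}1&0\\ b(x)&1\end{pmatrix}^{-1}.$$ If $T_b$ is a holomorphic automorphism of $\Omega$, then there are holomorphic functions $\alpha,\beta:\mathbb C\times\mathbb G_2\to\mathbb C$ such that $$b(x)=x_{11}\frac{1-\exp\big(x_{12}\,\alpha(x_{12},\operatorname{tr}x,\det x)\big)}{x_{12}}+\beta(x_{12},\operatorname{tr}x,\det x),\qquad x\in\Omega,$$ where the quotient is understood as extended holomorphically across $x_{12}=0$.
   Context: $\Omega=\Omega_2$ is the spectral ball, i.e. the domain of all $2\times2$ complex matrices $x=\begin{pmatrix}x_{11}&x_{12}\\ x_{21}&x_{22}\end{pmatrix}$ whose spectral radius is less than $1$. An automorphism of $\Omega$ is a biholomorphic self-map of $\Omega$. $\mathbb G_2=\{(\lambda_1+\lambda_2,\lambda_1\lambda_2):|\lambda_1|<1,|\lambda_2|<1\}\subset\mathbb C^2$ is the symmetrized bidisc, so $(\operatorname{tr}x,\det x)\in\mathbb G_2$ for $x\in\Omega$. *)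

(* Defs.v *)
From HB Require Import structures.
From mathcomp Require Import all_boot all_order all_algebra.
From mathcomp Require Import complex.
From mathcomp Require Import all_classical all_reals all_analysis.

Set Implicit Arguments.
Unset Strict Implicit.
Unset Printing Implicit Defensive.

Import Order.TTheory GRing.Theory Num.Theory numFieldNormedType.Exports.

Local Open Scope classical_set_scope.
Local Open Scope ring_scope.

(* R[i] already carries a scalar multiplication by R.  Through this alias it is
   seen only as a numClosedFieldType, so that the generic instances make Cx R,
   its products and its matrices normed modules over Cx R itself, and
   [differentiable] below means complex differentiable. *)
Definition Cx (R : realType) : numClosedFieldType := R[i].

Definition holomorphic_on (R : realType) (V W : normedModType (Cx R))
    (D : set V) (f : V -> W) : Prop :=
  forall x, D x -> differentiable f x.

(* exp(s + i t) = e^s (cos t + i sin t). *)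
Definition cexp (R : realType) (z : Cx R) : Cx R :=
  Complex (expR (complex.Re z) * cos (complex.Im z))
          (expR (complex.Re z) * sin (complex.Im z)).

Definition spectral_radius (R : realType) (x : 'M[Cx R]_2) : R :=
  sup [set complex.Re `|l| | l in [set l : Cx R | eigenvalue x l]].

Definition spectral_ball (R : realType) : set 'M[Cx R]_2 :=
  [set x | spectral_radius x < 1].

Definition symmetrized_bidisc (R : realType) : set (Cx R * Cx R) :=
  [set (l.1 + l.2, l.1 * l.2) |
     l in [set l : Cx R * Cx R | `|l.1| < 1 /\ `|l.2| < 1]].

(* Biholomorphic self-map of D; the values of f outside D are irrelevant. *)
Definition automorphism_of (R : realType) (V : normedModType (Cx R))
    (D : set V) (f : V -> V) : Prop :=
  [/\ holomorphic_on D f,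
      (forall x, D x -> D (f x)) &
      exists g : V -> V,
        [/\ holomorphic_on D g,
            (forall y, D y -> D (g y)),
            (forall x, D x -> g (f x) = x) &
            (forall y, D y -> f (g y) = y)]].

(* The matrix with rows (1, 0) and (c, 1). *)
Definition lower_unipotent (R : realType) (c : Cx R) : 'M[Cx R]_2 :=
  1%:M + c *: delta_mx 1 0.

Definition shear_conj (R : realType) (b : 'M[Cx R]_2 -> Cx R)
    (x : 'M[Cx R]_2) : 'M[Cx R]_2 :=
  lower_unipotent (b x) *m x *m invmx (lower_unipotent (b x)).

(* Main.v *)
Require Import Defs.
From HB Require Import structures.
From mathcomp Require Import all_boot all_order all_algebra.
From mathcomp Require Import complex.
From mathcomp Require Import all_classical all_reals all_analysis.
From mathcomp Require Import ring lra.

Set Implicit Arguments.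
Unset Strict Implicit.
Unset Printing Implicit Defensive.

Import Order.TTheory GRing.Theory Num.Theory numFieldNormedType.Exports.
Import complex.ComplexField.Normc.

Local Open Scope classical_set_scope.
Local Open Scope ring_scope.

(** The shear preserves the entry [z = x_12], the trace [s] and the determinant
    [p] of a matrix.  Where [z] is not zero, the fibre over [(z, s, p)] of these
    three functions is a complex line with coordinate [w = x_11], and the shear
    acts on it by [w |-> w - z * b].  This map and its inverse are entire, hence
    affine ([entire_automorphism_affine]).  So on each fibre [b] is an affine
    function of [w], and its slope and intercept are holomorphic functions of
    [(z, s, p)] for [z] not zero ([b_affine_on_fibres]).

    The slope and the intercept extend holomorphically across [z = 0].  If [s]
    and [p] come from distinct eigenvalues [l1] and [l2], the upper triangular
    matrices with diagonal [(l1, l2)] and [(l2, l1)] give two values of [b] on the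
    fibre that stay bounded as [z] tends to 0, and these values determine slope
    and intercept ([slope_intercept_bounded]).  Pairs [(s, p)] of this kind are
    dense, and a Cauchy integral in [z] gives the extension for all the others
    ([extension_across_zero]).

    Now [A = 1 - z * slope] is holomorphic on the product of the plane and the
    symmetrized bidisc.  It has no zero: for [z] not zero it is the linear
    coefficient of an injective affine map, and for [z = 0] it is 1.  Integrating
    its logarithmic derivative from 0 to [z] gives [A = exp (z * alpha)] with
    [alpha] holomorphic ([holomorphic_logarithm]).  The extended slope is then the
    quotient of the formula, and the extended intercept is [beta].

    The function theory is developed from complex differentiability alone:
    Goursat's lemma ([goursat]), the invariance of means over concentric circles
    ([circle_mean_invariant]), Cauchy's formula for a function with a removable
    singularity at the centre ([cauchy_formula_punctured]), Taylor estimates, and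
    the Fréchet differentiability of integrals that depend on a parameter
    ([segment_integral_differentiable]). *)

(** * Real-valued norms over the complex numbers *)

Section RealNorm.
Context (R : realType).
Local Notation C := (Cx R).

(** Typed in [Cx R], so that no term mixes the two scalar structures of the
    complex numbers. *)
Definition rc (x : R) : C := Complex x 0.

Fact rc_is_zmod_morphism : zmod_morphism rc.
Proof. by move=> x y; apply/eqP; rewrite eq_complex /= oppr0 addr0 !eqxx. Qed.

Fact rc_is_monoid_morphism : monoid_morphism rc.
Proof.
split=> // x y; apply/eqP.
by rewrite eq_complex /= !(mulr0, mul0r, subr0, addr0) !eqxx.
Qed.

HB.instance Definition _ := GRing.isZmodMorphism.Build R C rc rc_is_zmod_morphism.
HB.instance Definition _ :=
  GRing.isMonoidMorphism.Build R C rc rc_is_monoid_morphism.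

Lemma rc_le x y : (rc x <= rc y) = (x <= y).
Proof. exact: lecR. Qed.

Lemma rc_lt x y : (rc x < rc y) = (x < y).
Proof. exact: ltcR. Qed.

Lemma rc_gt0P (e : C) : 0 < e -> exists2 d : R, 0 < d & e = rc d.
Proof.
by case: e => a b; rewrite (@ltcE R) /= => /andP[/eqP -> a0]; exists a.
Qed.

(** Norms over [Cx R] are complex numbers and only partially ordered.  All
    estimates below are made with this real version, where linear arithmetic
    is available. *)
Definition nrm (V : normedModType C) (v : V) : R := complex.Re `|v|.

Section Norm.
Variable V : normedModType C.
Implicit Types u v w : V.

Lemma rc_nrm v : rc (nrm v) = `|v|.
Proof.
have := normr_ge0 v; rewrite /nrm; case: `|v| => a b /=.
by rewrite (@lecE R) /= => /andP[/eqP -> _].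
Qed.

Lemma nrm_ge0 v : 0 <= nrm v.
Proof. by rewrite -rc_le rc_nrm normr_ge0. Qed.

Lemma nrmD u v : nrm (u + v) <= nrm u + nrm v.
Proof. by rewrite -rc_le rmorphD /= !rc_nrm ler_normD. Qed.

Lemma nrmN v : nrm (- v) = nrm v.
Proof. by rewrite /nrm normrN. Qed.

Lemma nrm_distC u v : nrm (u - v) = nrm (v - u).
Proof. by rewrite /nrm distrC. Qed.

Lemma nrmB u v : nrm (u - v) <= nrm u + nrm v.
Proof. by rewrite -[in leRHS](nrmN v) nrmD. Qed.

Lemma nrm_dist u v w : nrm (u - v) <= nrm (u - w) + nrm (w - v).
Proof. by rewrite -[in leLHS](subrKA w) nrmD. Qed.

Lemma nrm0 : nrm (0 : V) = 0.
Proof. by rewrite /nrm normr0. Qed.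

Lemma nrm_eq0 v : (nrm v == 0) = (v == 0).
Proof. by rewrite -(normr_eq0 v) -rc_nrm -(rmorph0 rc) eq_complex /= eqxx andbT. Qed.

Lemma nrm_gt0 v : (0 < nrm v) = (v != 0).
Proof. by rewrite lt_def nrm_ge0 andbT nrm_eq0. Qed.

Lemma nrmZ (c : C) v : nrm (c *: v) = nrm c * nrm v.
Proof. by have [] : rc (nrm (c *: v)) = rc (nrm c * nrm v) by rewrite rmorphM /= !rc_nrm normrZ. Qed.

Lemma nrm_small v : (forall e, 0 < e -> nrm v <= e) -> v = 0.
Proof.
move=> h; apply/eqP; rewrite -nrm_eq0 eq_le nrm_ge0 andbT.
by apply/ler_addgt0Pr => e /h; rewrite add0r.
Qed.

Lemma nbhs_nrmP (x : V) (P : V -> Prop) :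
  (\forall y \near x, P y) <->
  exists2 d : R, 0 < d & forall y, nrm (y - x) < d -> P y.
Proof.
rewrite nbhs_normP; split=> [[e /= /rc_gt0P[d d0 ->] h]|[d d0 h]].
  by exists d => // y yd; apply: h; rewrite /= -rc_nrm rc_lt nrm_distC.
exists (rc d) => /=; first by rewrite -(rmorph0 rc) rc_lt.
by move=> y /=; rewrite -rc_nrm rc_lt nrm_distC; exact: h.
Qed.

End Norm.

Lemma nrm_pair (V W : normedModType C) (p : V * W) :
  nrm p = Num.max (nrm p.1) (nrm p.2).
Proof.
rewrite {1}/nrm prod_normE -!rc_nrm /Order.max rc_lt.
by case: ifP.
Qed.

Lemma nrmE (z : C) : nrm z = normc z. Proof. by []. Qed.

Lemma nrmM (z w : C) : nrm (z * w) = nrm z * nrm w.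
Proof. exact: normcM. Qed.

Lemma nrmV (z : C) : nrm z^-1 = (nrm z)^-1.
Proof. exact: normcV. Qed.

Lemma nrm_rc (x : R) : nrm (rc x) = `|x|.
Proof. by rewrite nrmE /= expr0n /= addr0 sqrtr_sqr. Qed.

Lemma nrm_Re (z : C) : `|complex.Re z| <= nrm z.
Proof.
by case: z => a b; rewrite nrmE /= -sqrtr_sqr ler_wsqrtr// lerDl sqr_ge0.
Qed.

Lemma nrm_Im (z : C) : `|complex.Im z| <= nrm z.
Proof.
by case: z => a b; rewrite nrmE /= -sqrtr_sqr ler_wsqrtr// lerDr sqr_ge0.
Qed.

Lemma nrm_ReIm (z : C) : nrm z <= `|complex.Re z| + `|complex.Im z|.
Proof.
case: z => a b; rewrite nrmE /=.
have h : 0 <= `|a| + `|b| by rewrite addr_ge0.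
rewrite -[leRHS]ger0_norm// -sqrtr_sqr ler_wsqrtr//.
rewrite sqrrD !real_normK ?num_real//.
by have := mulr_ge0 (normr_ge0 a) (normr_ge0 b); lra.
Qed.

Lemma continuous_nrmP (V W : normedModType C) (f : V -> W) x :
  {for x, continuous f} <->
  forall e : R, 0 < e -> exists2 d : R, 0 < d &
    forall y, nrm (y - x) < d -> nrm (f y - f x) < e.
Proof.
split=> [/cvgrPdist_lt fx e e0|h].
  apply/nbhs_nrmP; have e0' : 0 < rc e by rewrite -(rmorph0 rc) rc_lt.
  have := fx _ e0'; apply: filterS => y.
  by rewrite -rc_nrm rc_lt nrm_distC.
apply/cvgrPdist_lt => _ /rc_gt0P[e e0 ->].
have /nbhs_nrmP := h _ e0; apply: filterS => y.
by rewrite -[in X in _ -> X]rc_nrm rc_lt nrm_distC.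
Qed.

(** This lemma and its converse translate Fréchet differentiability into
    epsilon-delta form. *)
Lemma differentiable_nrm (V W : normedModType C) (f : V -> W) x :
  differentiable f x ->
  forall e : R, 0 < e -> exists2 d : R, 0 < d &
    forall h, nrm h < d -> nrm (f (x + h) - f x - 'd f x h) <= e * nrm h.
Proof.
move=> /diff_locallyP[_ /eqaddoP fx] e e0.
have e0' : 0 < rc e by rewrite -(rmorph0 rc) rc_lt.
have /nbhs_nrmP[d d0 hd] := fx _ e0'.
exists d => // h hh; have := hd h; rewrite subr0 => /(_ hh) /=.
rewrite -[`|h|]rc_nrm -[X in (X <= _)]rc_nrm -rmorphM rc_le /=.
rewrite -[X in nrm X <= _]/(f (h + x) - (f x + 'd f x h)).
by rewrite (addrC h) opprD addrA.
Qed.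

Lemma nrm_differentiable (V W : normedModType C) (f : V -> W) x
    (L : {linear V -> W}) :
  (exists2 k : R, 0 < k & forall h, nrm (L h) <= k * nrm h) ->
  (forall e : R, 0 < e -> exists2 d : R, 0 < d &
    forall h, nrm h < d -> nrm (f (x + h) - f x - L h) <= e * nrm h) ->
  differentiable f x /\ 'd f x = L :> (V -> W).
Proof.
move=> [k k0 kL] hf.
have cL : continuous L.
  apply/continuousfor0_continuous/continuous_nrmP => e e0.
  exists (e / k); first by rewrite divr_gt0.
  move=> y; rewrite subr0 linear0 subr0 ltr_pdivlMr// mulrC.
  exact/le_lt_trans/kL.
have dL : 'd f x = L :> (V -> W).
  apply: diff_unique => //.
  apply/eqaddoP => _ /rc_gt0P[e e0 ->].
  apply/nbhs_nrmP; have [d d0 hd] := hf _ e0.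
  exists d => // h; rewrite subr0 => /hd.
  rewrite -[`|h|]rc_nrm -[X in _ -> (X <= _)]rc_nrm -rmorphM rc_le /=.
  rewrite -[X in _ -> nrm X <= _]/(f (h + x) - (f x + L h)).
  by rewrite (addrC h) opprD addrA.
split=> //; apply/diff_locallyP; rewrite dL; split => //.
apply/eqaddoP => _ /rc_gt0P[e e0 ->].
apply/nbhs_nrmP; have [d d0 hd] := hf _ e0.
exists d => // h; rewrite subr0 => /hd.
rewrite -[`|h|]rc_nrm -[X in _ -> (X <= _)]rc_nrm -rmorphM rc_le /=.
rewrite -[X in _ -> nrm X <= _]/(f (h + x) - (f x + L h)).
by rewrite (addrC h) opprD addrA.
Qed.

Lemma differentiable_nrm1 (f : C -> C) x : differentiable f x ->
  forall e : R, 0 < e -> exists2 d : R, 0 < d &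
    forall h, nrm h < d -> nrm (f (x + h) - f x - 'd f x 1 * h) <= e * nrm h.
Proof.
move=> dfx e e0; have [d d0 hd] := differentiable_nrm dfx e0.
exists d => // h /hd; have -> // : 'd f x h = 'd f x 1 * h.
by rewrite -[h in LHS](mulr1 h) -[h * 1]/(h *: (1 : C)) linearZ mulrC.
Qed.

Lemma nrm1_differentiable (f : C -> C) x (a : C) :
  (forall e : R, 0 < e -> exists2 d : R, 0 < d &
    forall h, nrm h < d -> nrm (f (x + h) - f x - a * h) <= e * nrm h) ->
  differentiable f x /\ 'd f x 1 = a.
Proof.
move=> hf.
have [| |df ->] := @nrm_differentiable C C f x (GRing.scale a).
- exists (nrm a + 1); first by rewrite ltr_wpDl ?nrm_ge0.
  by move=> h; rewrite nrmZ ler_wpM2r ?nrm_ge0// lerDl.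
- exact: hf.
- by split=> //; rewrite -[LHS]/(a * 1) mulr1.
Qed.

End RealNorm.

(** * Integration over the unit segment *)

Section SegmentIntegral.
Context (R : realType).
Local Notation C := (Cx R).

(** The unit segment is placed inside the complex plane: integrands can then be
    holomorphic in the variable of integration too, and their continuity comes
    from the rules of differentiation. *)
Definition unit_segment : set C := [set rc t | t in `[0, 1]%classic].
Local Notation I01 := unit_segment.

Lemma unit_segment0 : I01 0.
Proof. by exists 0; rewrite ?rmorph0//= in_itv /= lexx ler01. Qed.

Lemma unit_segment_half t : I01 t -> I01 (t / 2).
Proof.
move=> [x]; rewrite /= in_itv /= => /andP[x0 x1] <-.
exists (x / 2); last by rewrite rmorphM fmorphV rmorph_nat.
by rewrite /= in_itv /=; apply/andP; split; lra.
Qed.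

Lemma unit_segment_half1 t : I01 t -> I01 ((1 + t) / 2).
Proof.
move=> [x]; rewrite /= in_itv /= => /andP[x0 x1] <-.
exists ((1 + x) / 2); last by rewrite rmorphM rmorphD rmorph1 fmorphV rmorph_nat.
by rewrite /= in_itv /=; apply/andP; split; lra.
Qed.

Lemma nrm_unit_segment t : I01 t -> nrm t <= 1.
Proof.
move=> [x]; rewrite /= in_itv /= => /andP[x0 x1] <-.
by rewrite nrm_rc ger0_norm.
Qed.

Lemma unit_segment_compact : compact I01.
Proof.
apply: continuous_compact; last exact: segment_compact.
apply: continuous_subspaceT => x; apply/cvgrPdist_lt => _ /rc_gt0P[e e0 ->].
near=> y; rewrite -rmorphB -rc_nrm nrm_rc rc_lt; near: y.
exact: (@cvgr_dist_lt _ _ _ (nbhs x) _ id).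
Unshelve. all: by end_near. Qed.

(** Tube lemma: a property that holds near each point of the compact set
    [unit_segment * e0] holds uniformly in a neighbourhood of [e0]. *)
Lemma unit_segment_tube (E : normedModType C) (e0 : E) (P : C -> E -> Prop) :
  (forall t, I01 t -> \forall p \near (t, e0), P p.1 p.2) ->
  exists2 d : R, 0 < d &
    forall t e, I01 t -> nrm (e - e0) < d -> P t e.
Proof.
move=> hP.
have /compact_near_coveringP/(_ E (nbhs e0) (fun e t => P t e)) :=
  unit_segment_compact.
case/(_ _ _)/nbhs_nrmP => [t It|d d0 hd]; first exact: hP.
by exists d => // t e It /hd; apply.
Qed.

Lemma unit_segment_uniform (E : normedModType C) (e0 : E) (G : C * E -> C) :
  (forall t, I01 t -> {for (t, e0), continuous G}) ->
  forall e : R, 0 < e -> exists2 d : R, 0 < d &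
    forall t u, I01 t -> nrm (u - e0) < d -> nrm (G (t, u) - G (t, e0)) < e.
Proof.
move=> cG e e_gt0; apply: unit_segment_tube => t It.
have /continuous_nrmP/(_ (e / 2)) := cG t It.
case=> [|d d0 hd]; first by rewrite divr_gt0.
apply/nbhs_nrmP; exists d => // -[t' u] /= tu.
apply: (le_lt_trans (nrm_dist _ _ (G (t, e0)))).
rewrite [e]splitr; apply: ltrD; first exact: hd.
rewrite nrm_distC; apply: hd; move: tu; apply: le_lt_trans; rewrite !nrm_pair /= subrr nrm0.
by rewrite ge_max !le_max lexx nrm_ge0.
Qed.

Lemma unit_segment_bounded (f : C -> C) :
  (forall t, I01 t -> {for t, continuous f}) ->
  exists2 M : R, 0 <= M & forall t, I01 t -> nrm (f t) <= M.
Proof.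
move=> cf.
have /compact_near_coveringP/(_ R (+oo)%R (fun M t => nrm (f t) <= M)) :=
  unit_segment_compact.
case/(_ _ _) => [t It|M [_ hM]].
  have /continuous_nrmP/(_ 1 ltr01)[d d0 hd] := cf t It.
  have near_t : \forall s \near t, nrm (s - t) < d by apply/nbhs_nrmP; exists d.
  near=> s M => /=.
  have -> : f s = (f s - f t) + f t by rewrite subrK.
  apply: (le_trans (nrmD _ _)).
  apply: (@le_trans _ _ (1 + nrm (f t))); first rewrite lerD2r ltW// hd//.
    by near: s.
  by near: M; apply: nbhs_pinfty_ge; exact: num_real.
have M0 : M < Num.max 0 M + 1 by rewrite ltr_pwDr// le_max lexx orbT.
exists (Num.max 0 M + 1); first by rewrite addr_ge0// le_max lexx.
exact: hM.
Unshelve. all: by end_near. Qed.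

(** The Riemann sum over the [2 ^ n] dyadic intervals, sampled at their left
    ends and organised by halving.  The recursion makes the behaviour of the
    integral under bisection immediate, and this is the only change of variable
    that Goursat's argument uses. *)
Fixpoint dyadic_mean n (f : C -> C) : C :=
  if n is m.+1 then
    (dyadic_mean m (fun t => f (t / 2)) + dyadic_mean m (fun t => f ((1 + t) / 2)))
      / 2
  else f 0.

Lemma nrm_half (z : C) : nrm (z / 2) = nrm z / 2.
Proof. by rewrite nrmM -(rmorph_nat (@rc R)) -fmorphV nrm_rc ger0_norm// invr_ge0. Qed.

Lemma dyadic_mean_ext n f g : (forall t, I01 t -> f t = g t) ->
  dyadic_mean n f = dyadic_mean n g.
Proof.
elim: n f g => [|n IH] f g fg /=; first exact/fg/unit_segment0.
congr ((_ + _) / _); apply: IH => t It; apply: fg.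
  exact: unit_segment_half.
exact: unit_segment_half1.
Qed.

Lemma dyadic_meanD n f g :
  dyadic_mean n (fun t => f t + g t) = dyadic_mean n f + dyadic_mean n g.
Proof. by elim: n f g => [|n IH] f g //=; rewrite !IH; ring. Qed.

Lemma dyadic_meanZ n a f :
  dyadic_mean n (fun t => a * f t) = a * dyadic_mean n f.
Proof. by elim: n f => [|n IH] f //=; rewrite !IH; ring. Qed.

Lemma dyadic_mean_cst n a : dyadic_mean n (fun=> a) = a.
Proof. by elim: n => [|n IH] //=; rewrite !IH; field. Qed.

Lemma nrm_dyadic_mean n f M :
  (forall t, I01 t -> nrm (f t) <= M) -> nrm (dyadic_mean n f) <= M.
Proof.
elim: n f => [|n IH] f fM /=; first exact/fM/unit_segment0.
rewrite nrm_half ler_pdivrMr// mulr_natr mulr2n.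
apply: (le_trans (nrmD _ _)); apply: lerD; apply: IH => t It; apply: fM.
  exact: unit_segment_half.
exact: unit_segment_half1.
Qed.

(** Refining a dyadic subdivision moves each sample within its own interval, so
    the mean moves at most by the oscillation of [f] at that scale. *)
Lemma dyadic_mean_modulus n m f e :
  (forall s t, I01 s -> I01 t -> nrm (s - t) <= 2^-1 ^+ n ->
     nrm (f s - f t) <= e) ->
  nrm (dyadic_mean (n + m) f - dyadic_mean n f) <= e.
Proof.
elim: n f => [|n IH] f fe.
  rewrite add0n /= -(dyadic_mean_cst m (- f 0)) -dyadic_meanD.
  apply: nrm_dyadic_mean => t It; apply: fe => //; first exact: unit_segment0.
  by rewrite subr0 expr0 nrm_unit_segment.
rewrite addSn /= -mulrBl nrm_half ler_pdivrMr// mulr_natr mulr2n.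
rewrite opprD addrACA; apply: (le_trans (nrmD _ _)).
have half2 (x : R) : x <= 2^-1 ^+ n -> x / 2 <= 2^-1 ^+ n.+1.
  by move=> hx; rewrite exprSr ler_pM2r// invr_gt0.
apply: lerD; apply: IH => s t Is It st; apply: fe.
- exact: unit_segment_half.
- exact: unit_segment_half.
- by rewrite -mulrBl nrm_half half2.
- exact: unit_segment_half1.
- exact: unit_segment_half1.
- by rewrite -mulrBl opprD addrACA subrr add0r nrm_half half2.
Qed.

Definition is_segment_integral (f : C -> C) (c : C) :=
  forall e : R, 0 < e -> exists N, forall n, (N <= n)%N ->
    nrm (dyadic_mean n f - c) <= e.

(** A record rather than a plain definition: proof search must not unfold it
    into a statement about filters. *)
Record segment_continuous (f : C -> C) : Prop := SegmentContinuous
  { segment_continuousP : forall t, I01 t -> {for t, continuous f} }.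

Lemma segment_unif_continuous f : segment_continuous f ->
  forall e : R, 0 < e -> exists2 d : R, 0 < d &
    forall s t, I01 s -> I01 t -> nrm (s - t) < d -> nrm (f s - f t) < e.
Proof.
move=> cf e e0.
have [|d d0 hd] := @unit_segment_uniform C 0 (fun p => f (p.1 + p.2)) _ e e0.
  move=> t It; apply/continuous_nrmP => e1 e10 /=.
  have /continuous_nrmP/(_ _ e10)[d d0 hd] := segment_continuousP cf It.
  exists (d / 2); first by rewrite divr_gt0.
  move=> [s u]; rewrite nrm_pair /= addr0 subr0 gt_max => /andP[st su].
  apply: hd; rewrite addrAC; apply: (le_lt_trans (nrmD _ _)).
  by rewrite [d]splitr ltrD.
exists d => // s t Is It st.
by have := hd t (s - t) It; rewrite subr0 /= addr0 [t + _]addrC subrK; apply.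
Qed.

Lemma real_cauchy_cvg (u : nat -> R) :
  (forall e : R, 0 < e -> exists N, forall n, (N <= n)%N -> `|u n - u N| <= e) ->
  exists l : R, forall e : R, 0 < e -> exists N, forall n, (N <= n)%N ->
    `|u n - l| <= e.
Proof.
move=> cu.
have /cauchy_cvgP/cvg_ex[l /cvgrPdist_le hl] : cauchy (u @ \oo).
  apply/cauchy_exP => e e0.
  have [|N hN] := cu (e / 2); first by rewrite divr_gt0.
  exists (u N); exists N => // n /= Nn; rewrite -ball_normE /= distrC.
  by rewrite (le_lt_trans (hN _ Nn))// ltr_pdivrMr// ltr_pMr// ltr1n.
exists l => e /hl[N _ hN]; exists N => n Nn.
by rewrite distrC; exact: hN.
Qed.

Lemma exp_half_lt (e : R) : 0 < e -> exists n, 2^-1 ^+ n < e.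
Proof.
move=> e0; have /cvgrPdist_lt/(_ _ e0)[n _ hn] :
    (fun n => (2^-1 : R) ^+ n) @ \oo --> 0.
  by apply: cvg_expr; rewrite ger0_norm ?invr_ge0// invf_lt1// ltr1n.
by exists n; have := hn n (leqnn n); rewrite /= sub0r normrN ger0_norm ?exprn_ge0// invr_ge0.
Qed.

Lemma segment_integral_exists f : segment_continuous f ->
  exists c, is_segment_integral f c.
Proof.
move=> cf.
have cauchy e : 0 < e -> exists N, forall n, (N <= n)%N ->
    nrm (dyadic_mean n f - dyadic_mean N f) <= e.
  move=> e0; have [d d0 hd] := segment_unif_continuous cf e0.
  have [N Nd] := exp_half_lt d0; exists N => n /subnKC <-.
  apply: dyadic_mean_modulus => s t Is It st.
  by rewrite ltW// hd// (le_lt_trans st).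
have [e e0|a ha] := @real_cauchy_cvg (fun n => complex.Re (dyadic_mean n f)).
  have [N hN] := cauchy e e0; exists N => n /hN.
  by apply: le_trans; rewrite -raddfB /=; exact: nrm_Re.
have [e e0|b hb] := @real_cauchy_cvg (fun n => complex.Im (dyadic_mean n f)).
  have [N hN] := cauchy e e0; exists N => n /hN.
  by apply: le_trans; rewrite -raddfB /=; exact: nrm_Im.
exists (Complex a b) => e e0.
have e2 : 0 < e / 2 by rewrite divr_gt0.
have [N1 h1] := ha _ e2; have [N2 h2] := hb _ e2.
exists (maxn N1 N2) => n; rewrite geq_max => /andP[n1 n2].
apply: (le_trans (nrm_ReIm _)); rewrite [e]splitr.
by rewrite !raddfB /=; apply: lerD; [exact: h1|exact: h2].
Qed.

Lemma segment_integral_unique f c d :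
  is_segment_integral f c -> is_segment_integral f d -> c = d.
Proof.
move=> fc fd; apply/eqP; rewrite -subr_eq0; apply/eqP/nrm_small => e e0.
have e2 : 0 < e / 2 by rewrite divr_gt0.
have [N1 h1] := fc _ e2; have [N2 h2] := fd _ e2.
apply: (le_trans (nrm_dist _ _ (dyadic_mean (maxn N1 N2) f))).
rewrite [e]splitr nrm_distC; apply: lerD; [apply: h1|apply: h2].
  exact: leq_maxl.
exact: leq_maxr.
Qed.

Definition segment_integral f : C := get (is_segment_integral f).

Lemma segment_integralP f : segment_continuous f ->
  is_segment_integral f (segment_integral f).
Proof. by move=> /segment_integral_exists[c hc]; exact: (getI hc). Qed.

Lemma segment_integralE f c : is_segment_integral f c -> segment_integral f = c.
Proof. by move=> fc; apply: segment_integral_unique (fc); exact: (getI fc). Qed.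

Lemma segment_integral_ext f g : (forall t, I01 t -> f t = g t) ->
  segment_integral f = segment_integral g.
Proof.
move=> fg; rewrite /segment_integral; congr get.
apply/predeqP => c; split=> h e e0; have [N hN] := h e e0; exists N => n /hN.
  by rewrite (dyadic_mean_ext _ fg).
by rewrite (dyadic_mean_ext _ fg).
Qed.

Lemma segment_integralD f g : segment_continuous f -> segment_continuous g ->
  segment_integral (fun t => f t + g t) = segment_integral f + segment_integral g.
Proof.
move=> /segment_integralP hf /segment_integralP hg; apply: segment_integralE.
move=> e e0; have e2 : 0 < e / 2 by rewrite divr_gt0.
have [N1 h1] := hf _ e2; have [N2 h2] := hg _ e2.
exists (maxn N1 N2) => n; rewrite geq_max => /andP[n1 n2].
rewrite dyadic_meanD opprD addrACA; apply: (le_trans (nrmD _ _)).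
by rewrite [e]splitr; apply: lerD; [exact: h1|exact: h2].
Qed.

Lemma segment_integralZ a f : segment_continuous f ->
  segment_integral (fun t => a * f t) = a * segment_integral f.
Proof.
move=> /segment_integralP hf; apply: segment_integralE => e e0.
have a0 : 0 < nrm a + 1 by rewrite ltr_wpDl// nrm_ge0.
have [|N hN] := hf (e / (nrm a + 1)); first by rewrite divr_gt0.
exists N => n /hN; rewrite dyadic_meanZ -mulrBr nrmM => h.
apply: (le_trans (ler_wpM2l (nrm_ge0 _) h)).
by rewrite mulrCA ler_piMr ?ltW// ltr_pdivrMr// mul1r ltrDl.
Qed.

Lemma segment_integral_cst a : segment_integral (fun=> a) = a.
Proof.
apply: segment_integralE => e e0; exists 0%N => n _.
by rewrite dyadic_mean_cst subrr nrm0 ltW.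
Qed.

Lemma nrm_segment_integral f M : segment_continuous f ->
  (forall t, I01 t -> nrm (f t) <= M) -> nrm (segment_integral f) <= M.
Proof.
move=> /segment_integralP hf fM; apply/ler_addgt0Pr => e /hf[N /(_ N (leqnn N)) hN].
have -> : segment_integral f = dyadic_mean N f - (dyadic_mean N f - segment_integral f).
  by rewrite subKr.
by apply: (le_trans (nrmB _ _)); apply: lerD => //; exact: nrm_dyadic_mean.
Qed.

Lemma segment_continuous_cst a : segment_continuous (fun=> a).
Proof. by split=> t _; exact: cst_continuous. Qed.

Lemma segment_continuousM f g : segment_continuous f -> segment_continuous g ->
  segment_continuous (fun t => f t * g t).
Proof. by move=> [cf] [cg]; split=> t It; exact: (continuousM (cf t It) (cg t It)). Qed.

Lemma segment_continuousB f g : segment_continuous f -> segment_continuous g ->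
  segment_continuous (fun t => f t - g t).
Proof. by move=> [cf] [cg]; split=> t It; exact: (continuousB (cf t It) (cg t It)). Qed.

Lemma segment_integralB f g : segment_continuous f -> segment_continuous g ->
  segment_integral (fun t => f t - g t) = segment_integral f - segment_integral g.
Proof.
move=> cf cg.
have cNg : segment_continuous (fun t => -1 * g t).
  exact: (segment_continuousM (segment_continuous_cst _) cg).
have -> : - segment_integral g = segment_integral (fun t => -1 * g t).
  by rewrite (segment_integralZ _ cg) mulN1r.
rewrite -(segment_integralD cf cNg).
by apply: segment_integral_ext => t _; rewrite mulN1r.
Qed.

Lemma continuous_affine (a b t : C) : {for t, continuous (fun t => a + b * t)}.
Proof.
apply/continuous_nrmP => e e0; have b0 : 0 < nrm b + 1 by rewrite ltr_wpDl ?nrm_ge0.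
exists (e / (nrm b + 1)); first by rewrite divr_gt0.
move=> y; rewrite ltr_pdivlMr// => h.
have -> : a + b * y - (a + b * t) = (y - t) * b by ring.
rewrite nrmM (le_lt_trans _ h)// ler_wpM2l ?nrm_ge0//.
by rewrite lerDl.
Qed.

Lemma continuous_comp_affine (f : C -> C) (a b t : C) :
  {for a + b * t, continuous f} -> {for t, continuous (fun t => f (a + b * t))}.
Proof. by move=> cf; apply: continuous_comp; [exact: continuous_affine|]. Qed.

(** A dyadic mean of level [n.+1] is by definition the average of the two means of
    level [n] over the halves; the lemma is the limit of this identity. *)
Lemma segment_integral_half f : segment_continuous f ->
  segment_integral f = (segment_integral (fun t => f (t / 2)) +
                        segment_integral (fun t => f ((1 + t) / 2))) / 2.
Proof.
move=> cf; apply: segment_integralE => e e0.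
have /segment_integralP/(_ e e0)[N1 h1] : segment_continuous (fun t => f (t / 2)).
  split=> t It; have := @continuous_comp_affine f 0 2^-1 t.
  rewrite add0r mulrC.
  have -> : (fun t => f (0 + 2^-1 * t)) = (fun t => f (t / 2)).
    by apply/funext => u; rewrite add0r mulrC.
  by apply; exact/(segment_continuousP cf)/unit_segment_half.
have /segment_integralP/(_ e e0)[N2 h2] :
    segment_continuous (fun t => f ((1 + t) / 2)).
  split=> t It; have := @continuous_comp_affine f 2^-1 2^-1 t.
  have -> : (fun t => f (2^-1 + 2^-1 * t)) = (fun t => f ((1 + t) / 2)).
    by apply/funext => u; rewrite mulrDl mul1r [u / 2]mulrC.
  have -> : 2^-1 + 2^-1 * t = (1 + t) / 2 by rewrite mulrDl mul1r [t / 2]mulrC.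
  by apply; exact/(segment_continuousP cf)/unit_segment_half1.
exists (maxn N1 N2).+1 => -[//|n]; rewrite ltnS geq_max => /andP[n1 n2] /=.
rewrite -mulrBl nrm_half ler_pdivrMr// mulr_natr mulr2n opprD addrACA.
by apply: (le_trans (nrmD _ _)); apply: lerD; [exact: h1|exact: h2].
Qed.

Lemma segment_integral_affine a b :
  segment_integral (fun t => a + b * t) = a + b / 2.
Proof.
have mean_id n : dyadic_mean n (fun t => a + b * t) = a + b * (1 - 2^-1 ^+ n) / 2.
  elim: n a b => [|n IH] a1 b1; first by rewrite /= expr0; ring.
  rewrite /= exprS.
  rewrite (@dyadic_mean_ext n (fun t => _ + _ * (t / 2)) (fun t => a1 + b1 / 2 * t));
    last by move=> t _; ring.
  rewrite (@dyadic_mean_ext n (fun t => _ + _ * (_ / _))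
    (fun t => (a1 + b1 / 2) + b1 / 2 * t)); last by move=> t _; field.
  by rewrite !IH; field.
apply: segment_integralE => e e0.
have b0 : 0 < nrm b + 1 by rewrite ltr_wpDl ?nrm_ge0.
have [N hN] := @exp_half_lt (e / (nrm b + 1)) (divr_gt0 e0 b0).
exists N => n /subnKC <-; rewrite mean_id.
have -> : a + b * (1 - 2^-1 ^+ (N + (n - N))) / 2 - (a + b / 2) =
   - (b * rc (2^-1 ^+ (N + (n - N))) / 2).
  by rewrite rmorphXn fmorphV rmorph_nat; field.
rewrite nrmN nrm_half nrmM nrm_rc ger0_norm ?exprn_ge0 ?invr_ge0//.
set x := _ ^+ _; have x0 : 0 <= x by rewrite exprn_ge0 ?invr_ge0.
have : x < e / (nrm b + 1).
  apply: le_lt_trans hN; rewrite /x exprD ler_piMr ?exprn_ge0 ?invr_ge0//.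
  by rewrite exprn_ile1 ?invr_ge0// invf_le1// ler1n.
rewrite ltr_pdivlMr// => hx.
rewrite ler_pdivrMr//; have := nrm_ge0 b; move: hx; nra.
Qed.

Lemma segment_integral_continuous (E : normedModType C) (e0 : E) (G : C * E -> C) :
  (exists2 d : R, 0 < d & forall t e, I01 t -> nrm (e - e0) < d ->
    {for (t, e), continuous G}) ->
  {for e0, continuous (fun e => segment_integral (fun t => G (t, e)))}.
Proof.
move=> [d d0 cG]; apply/continuous_nrmP => e e_gt0.
have e2 : 0 < e / 2 by rewrite divr_gt0.
have cG1 u : nrm (u - e0) < d -> segment_continuous (fun t => G (t, u)).
  move=> ud; split=> t It; apply/continuous_nrmP => e1 e10.
  have /continuous_nrmP/(_ _ e10)[d1 d10 h] := cG t u It ud.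
  exists d1 => // s st; apply: h.
  by rewrite nrm_pair /= subrr nrm0 gt_max st d10.
have [|d1 d10 hd1] := @unit_segment_uniform E e0 G _ _ e2.
  by move=> t It; apply: cG; rewrite ?subrr ?nrm0.
exists (Num.min d d1); first by rewrite lt_min d0.
move=> u; rewrite lt_min => /andP[ud ud1].
have c0 : segment_continuous (fun t => G (t, e0)) by apply: cG1; rewrite subrr nrm0.
rewrite -segment_integralB//; last exact: cG1.
apply: (@le_lt_trans _ _ (e / 2)); last by rewrite ltr_pdivrMr// ltr_pMr// ltr1n.
apply: nrm_segment_integral; first by apply: segment_continuousB => //; exact: cG1.
by move=> t It; rewrite ltW// hd1.
Qed.

End SegmentIntegral.

(** * Goursat's lemma *)

Section Goursat.
Context (R : realType).
Local Notation C := (Cx R).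
Variables (g : C -> C) (a v w : C).

Local Notation pt x y := (a + rc x * v + rc y * w).
Local Notation vec x y := (rc x * v + rc y * w).

(** The integral of [f] along the segment from [p] to [p + u]. *)
Definition path_integral (f : C -> C) (p u : C) : C :=
  u * segment_integral (fun t => f (p + u * t)).

Let S x y dx dy := path_integral g (pt x y) (vec dx dy).

(** The integral over the boundary of the triangle with vertices [p], [p + u1]
    and [p + u1 + u2]. *)
Definition triangle_integral (f : C -> C) (p u1 u2 : C) : C :=
  path_integral f p u1 + path_integral f (p + u1) u2 - path_integral f p (u1 + u2).

Definition in01 (x : R) : Prop := 0 <= x <= 1.

Hypothesis dg : forall x y, in01 x -> in01 y -> differentiable g (pt x y).

Let convex01 x d t : in01 x -> in01 (x + d) -> in01 t -> in01 (x + d * t).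
Proof. by rewrite /in01 => /andP[? ?] /andP[? ?] /andP[? ?]; apply/andP; split; nra. Qed.

Let pt_vec x y dx dy (t : R) :
  pt x y + vec dx dy * rc t = pt (x + dx * t) (y + dy * t).
Proof. by rewrite !rmorphD !rmorphM /=; ring. Qed.

Let cont_S x y dx dy : in01 x -> in01 (x + dx) -> in01 y -> in01 (y + dy) ->
  segment_continuous (fun t => g (pt x y + vec dx dy * t)).
Proof.
move=> x0 x1 y0 y1; split=> _ [t t01 <-].
apply: continuous_comp_affine; rewrite pt_vec.
by apply: differentiable_continuous; apply: dg; exact: convex01.
Qed.

Let split_S x y dx dy :
  in01 x -> in01 (x + (dx + dx)) -> in01 y -> in01 (y + (dy + dy)) ->
  S x y (dx + dx) (dy + dy) = S x y dx dy + S (x + dx) (y + dy) dx dy.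
Proof.
move=> x0 x1 y0 y1; rewrite /S /path_integral (segment_integral_half (cont_S x0 x1 y0 y1)).
have -> : vec (dx + dx) (dy + dy) = 2 * vec dx dy by rewrite !rmorphD; ring.
set I1 := segment_integral _; set I2 := segment_integral _.
set J1 := segment_integral _; set J2 := segment_integral _.
have -> : I1 = J1.
  by apply: segment_integral_ext => t _; congr (g (_ + _)); field.
have -> : I2 = J2.
  apply: segment_integral_ext => t _; congr g.
  by rewrite !rmorphD /=; field.
by field.
Qed.

(** The boundary integrals of the triangles met in the bisection.  They are the
    homothetic images, of ratio [h], of the two halves into which the diagonal
    [v + w] cuts the parallelogram; [b] tells which half. *)
Let T (b : bool) x y h : C :=
  if b then S x y 0 h + S x (y + h) h 0 - S x y h h
  else S x y h 0 + S (x + h) y 0 h - S x y h h.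

(** Joining the midpoints of the sides cuts a triangle into three triangles of
    the same kind and one of the other kind, the latter with the opposite
    orientation. *)
Let split_T b (x y h : R) : 0 <= h -> 0 <= x -> x + (h + h) <= 1 -> 0 <= y -> y + (h + h) <= 1 ->
  T b x y (h + h) =
    if b then T b x y h + T b x (y + h) h + T b (x + h) (y + h) h - T false x (y + h) h
    else T b x y h + T b (x + h) y h + T b (x + h) (y + h) h - T true (x + h) y h.
Proof.
move=> h0 x0 x1 y0 y1.
have S1 (x' y' : R) : 0 <= x' -> x' + (h + h) <= 1 -> 0 <= y' <= 1 ->
    S x' y' (h + h) 0 = S x' y' h 0 + S (x' + h) y' h 0.
  move=> ? ? /andP[? ?]; have := @split_S x' y' h 0; rewrite !addr0; apply;
  by rewrite /in01; apply/andP; split; lra.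
have S2 (x' y' : R) : 0 <= y' -> y' + (h + h) <= 1 -> 0 <= x' <= 1 ->
    S x' y' 0 (h + h) = S x' y' 0 h + S x' (y' + h) 0 h.
  move=> ? ? /andP[? ?]; have := @split_S x' y' 0 h; rewrite !addr0; apply;
  by rewrite /in01; apply/andP; split; lra.
have S3 : S x y (h + h) (h + h) = S x y h h + S (x + h) (y + h) h h.
  by apply: split_S; rewrite /in01; apply/andP; split; lra.
have ey : y + h + h = y + (h + h) by rewrite addrA.
have ex : x + h + h = x + (h + h) by rewrite addrA.
have S1y : S x (y + (h + h)) (h + h) 0 =
    S x (y + h + h) h 0 + S (x + h) (y + h + h) h 0.
  by rewrite ey; apply: S1 => //; apply/andP; split; lra.
have S1x : S x y (h + h) 0 = S x y h 0 + S (x + h) y h 0.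
  by apply: S1 => //; apply/andP; split; lra.
have S2x : S (x + (h + h)) y 0 (h + h) =
    S (x + h + h) y 0 h + S (x + h + h) (y + h) 0 h.
  by rewrite ex; apply: S2 => //; apply/andP; split; lra.
have S2y : S x y 0 (h + h) = S x y 0 h + S x (y + h) 0 h.
  by apply: S2 => //; apply/andP; split; lra.
have cancel (p1 p2 p3 p4 p5 p6 q1 q2 q3 : C) : p1 + p2 + (p3 + p4) - (p5 + p6) =
  p1 + q1 - p5 + (p2 + p3 - q2) + (q3 + p4 - p6) - (q1 + q3 - q2) by ring.
rewrite /T; case: b; first by rewrite S2y S1y S3; exact: cancel.
by rewrite S1x S2x S3; exact: cancel.
Qed.

Let quarter (z1 z2 z3 z4 : C) (M : R) : nrm z1 < M -> nrm z2 < M -> nrm z3 < M ->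
  nrm z4 < M -> nrm (z1 + z2 + z3 - z4) < M * 4.
Proof.
move=> h1 h2 h3 h4; have := nrmB (z1 + z2 + z3) z4.
by have := nrmD (z1 + z2) z3; have := nrmD z1 z2; lra.
Qed.

Let valid (x y h : R) := [/\ 0 <= h, 0 <= x, x + h <= 1, 0 <= y & y + h <= 1].

(** One of the four pieces carries at least a quarter of the integral. *)
Let step b (x y h : R) : valid x y (h + h) ->
  exists b' x' y', [/\ valid x' y' h, x <= x' <= x + h, y <= y' <= y + h &
    nrm (T b x y (h + h)) <= nrm (T b' x' y' h) * 4].
Proof.
move=> [h0 x0 x1 y0 y1].
have hh : 0 <= h by lra.
apply: contrapT => no.
have small b' x' y' : (x' == x) || (x' == x + h) -> (y' == y) || (y' == y + h) ->
    nrm (T b' x' y' h) < nrm (T b x y (h + h)) / 4.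
  move=> hx hy; rewrite ltNge; apply/negP => big; apply: no.
  exists b', x', y'; split.
  - by move: hx hy => /orP[]/eqP-> /orP[]/eqP->; split; lra.
  - by move: hx => /orP[]/eqP->; apply/andP; split; lra.
  - by move: hy => /orP[]/eqP->; apply/andP; split; lra.
  - by move: big; rewrite ler_pdivrMr.
have : nrm (T b x y (h + h)) < nrm (T b x y (h + h)) / 4 * 4.
  rewrite {1}split_T //; case: b no small => _ small; apply: quarter;
  by apply: small; rewrite !eqxx ?orbT.
by rewrite divfK ?pnatr_eq0// ltxx.
Qed.

Let half_pow n : (2^-1 : R) ^+ n.+1 + 2^-1 ^+ n.+1 = 2^-1 ^+ n.
Proof. by rewrite exprS; lra. Qed.

Let pow_gt0 n : 0 < (2^-1 : R) ^+ n.
Proof. by rewrite exprn_gt0// invr_gt0. Qed.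

Let nested : exists (x y : nat -> R) (b : nat -> bool), forall n,
  [/\ valid (x n) (y n) (2^-1 ^+ n), x n <= x n.+1 <= x n + 2^-1 ^+ n.+1,
      y n <= y n.+1 <= y n + 2^-1 ^+ n.+1 &
      nrm (T false 0 0 1) <= nrm (T (b n) (x n) (y n) (2^-1 ^+ n)) * 4 ^+ n].
Proof.
pose P n (s : bool * (R * R)) := valid s.2.1 s.2.2 (2^-1 ^+ n) /\
  nrm (T false 0 0 1) <= nrm (T s.1 s.2.1 s.2.2 (2^-1 ^+ n)) * 4 ^+ n.
pose Q n (s s' : bool * (R * R)) :=
  s.2.1 <= s'.2.1 <= s.2.1 + 2^-1 ^+ n.+1 /\ s.2.2 <= s'.2.2 <= s.2.2 + 2^-1 ^+ n.+1.
have next n s : P n s -> exists s', P n.+1 s' /\ Q n s s'.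
  case: s => b [x y] [/= vs h].
  rewrite -half_pow in vs; have [b' [x' [y' [vs' hx hy hT]]]] := step b vs.
  exists (b', (x', y')); split; split => //=.
  rewrite half_pow in hT; apply: (le_trans h).
  rewrite (exprS 4) mulrA; apply: ler_wpM2r hT; exact: exprn_ge0.
pose rel (s s' : nat * (bool * (R * R))) :=
  s'.1 = s.1.+1 /\ (P s.1 s.2 -> P s'.1 s'.2 /\ Q s.1 s.2 s'.2).
have [s|f [f0 fS]] := @dependent_choice _ rel _ (0%N, (false, (0, 0))).
  apply: cid; have [/next[s' hs']|no] := pselect (P s.1 s.2).
    by exists (s.1.+1, s').
  by exists (s.1.+1, s.2); split=> // /no.
have f1 n : (f n).1 = n.
  by elim: n => [|n IH]; [rewrite f0|case: (fS n) => -> _; rewrite IH].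
have fP n : P n (f n).2.
  elim: n => [|n IH].
    by rewrite f0; split; rewrite /= ?expr0 ?mulr1//; split=> //; rewrite ?add0r ?lexx ?ler01.
  by case: (fS n) => _; rewrite !f1 => /(_ IH)[].
exists (fun n => (f n).2.2.1), (fun n => (f n).2.2.2), (fun n => (f n).2.1) => n.
have [vs hT] := fP n; case: (fS n) => _; rewrite !f1 => /(_ (fP n))[_ [hx hy]].
by split.
Qed.

(** The intervals from [x n] to [x n + 2^-n] are nested. *)
Let nested_limit (x : nat -> R) :
  (forall n, x n <= x n.+1 <= x n + 2^-1 ^+ n.+1) ->
  exists l, forall n, x n <= l <= x n + 2^-1 ^+ n.
Proof.
move=> hx.
have mono n m : x n <= x (n + m)%N <= x n + 2^-1 ^+ n - 2^-1 ^+ (n + m).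
  elim: m => [|m /andP[IH1 IH2]]; first by rewrite addn0 lexx addrK lexx.
  have /andP[h1 h2] := hx (n + m)%N; have := half_pow (n + m)%N.
  by rewrite addnS => h; apply/andP; split; lra.
have [e e0|l hl] := @real_cauchy_cvg R x.
  have [N hN] := exp_half_lt e0; exists N => n /subnKC <-.
  have /andP[h1 h2] := mono N (n - N)%N; rewrite ger0_norm ?subr_ge0//.
  by have := pow_gt0 (N + (n - N)); lra.
exists l => n; apply/andP; split; apply/ler_addgt0Pr => e /hl[N] => hN.
  have /andP[h1 h2] := mono n N; have := hN (n + N)%N (leq_addl _ _).
  by rewrite ler_norml => /andP[]; lra.
have /andP[h1 h2] := mono n N; have := hN (n + N)%N (leq_addl _ _).
by rewrite ler_norml => /andP[]; have := pow_gt0 (n + N); lra.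
Qed.

Let K := nrm v + nrm w + 1.

Let nrm_vec x y (h : R) : 0 <= h -> `|x| <= h -> `|y| <= h -> nrm (vec x y) <= h * K.
Proof.
move=> h0 xh yh; apply: (le_trans (nrmD _ _)); rewrite !nrmM !nrm_rc /K.
by have := nrm_ge0 v; have := nrm_ge0 w; nra.
Qed.

(** An affine function is integrated exactly, so the error comes only from its
    distance to [g]. *)
Let affine_S (al be : C) x y dx dy (e h : R) : 0 <= e -> 0 <= h ->
  in01 x -> in01 (x + dx) -> in01 y -> in01 (y + dy) -> `|dx| <= h -> `|dy| <= h ->
  (forall x' y', in01 x' -> in01 y' -> `|x' - x| <= h -> `|y' - y| <= h ->
     nrm (g (pt x' y') - (al + be * pt x' y')) <= e) ->
  nrm (S x y dx dy - vec dx dy * (al + be * pt x y + be * vec dx dy / 2)) <= h * K * e.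
Proof.
move=> e0 h0 x0 x1 y0 y1 dxh dyh he.
rewrite -segment_integral_affine /S /path_integral -mulrBr.
rewrite nrmM; apply: ler_pM; rewrite ?nrm_ge0 ?nrm_vec//.
have caff : segment_continuous
    (fun t => al + be * pt x y + be * vec dx dy * t).
  by split=> t _; exact: continuous_affine.
rewrite -(segment_integralB (cont_S x0 x1 y0 y1) caff).
apply: nrm_segment_integral; first exact: (segment_continuousB (cont_S x0 x1 y0 y1) caff).
move=> _ [t t01 <-].
have -> : al + be * pt x y + be * vec dx dy * rc t =
  al + be * (pt x y + vec dx dy * rc t) by ring.
rewrite pt_vec; move: (t01); rewrite /= in_itv /= => /andP[t0 t1].
apply: he; [exact: convex01|exact: convex01| |];
  rewrite addrAC subrr add0r normrM (ger0_norm t0).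
  by apply: le_trans dxh; rewrite ler_piMr.
by apply: le_trans dyh; rewrite ler_piMr.
Qed.

(** If the integral were not zero, bisection would give nested triangles of size
    [2^-n] whose integrals are at least [4^-n] times the first one.  They shrink
    to a point where [g] is differentiable.  There [g] is affine up to an error
    which is small compared to [2^-n], affine functions have zero integral, and
    so the integrals are small compared to [4^-n]. *)
Lemma goursat : triangle_integral g a v w = 0.
Proof.
have -> : triangle_integral g a v w = T false 0 0 1.
  rewrite /triangle_integral /T /S !rmorph0 !add0r rmorph1.
  by rewrite !mul0r !mul1r !addr0 !add0r.
have [x [y [b hn]]] := nested.
have [l1 hl1] : exists l, forall n, x n <= l <= x n + 2^-1 ^+ n.
  by apply: nested_limit => n; case: (hn n).
have [l2 hl2] : exists l, forall n, y n <= l <= y n + 2^-1 ^+ n.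
  by apply: nested_limit => n; case: (hn n).
have K0 : 0 < K by rewrite /K; have := nrm_ge0 v; have := nrm_ge0 w; lra.
have [_ x0 x1 y0 y1] : valid (x 0%N) (y 0%N) 1 by case: (hn 0%N).
have l01 : in01 l1 /\ in01 l2.
  have /andP[? ?] := hl1 0%N; have /andP[? ?] := hl2 0%N.
  by rewrite /in01; split; apply/andP; split; lra.
apply: nrm_small => e e_gt0.
(* On three sides of length at most [K * h], [g] differs from an affine
   function by at most [2 * e' * h * K]. *)
set e' := e / (6 * K ^+ 2).
have e'0 : 0 < e' by rewrite divr_gt0// mulr_gt0// exprn_gt0.
have [d d0 hd] := differentiable_nrm1 (dg l01.1 l01.2) e'0.
set c := pt l1 l2 in hd; set be := 'd g c 1 in hd.
have [|n hnd] := @exp_half_lt R (d / (2 * K)); first by rewrite divr_gt0// mulr_gt0.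
have [[h0 xn0 xn1 yn0 yn1] _ _ hT] := hn n.
have := hl1 n; have := hl2 n; set h := 2^-1 ^+ n in h0 xn1 yn1 hT hnd *.
move=> /andP[yl1 yl2] /andP[xl1 xl2].
have near_affine x' y' : in01 x' -> in01 y' -> `|x' - l1| <= 2 * h -> `|y' - l2| <= 2 * h ->
    nrm (g (pt x' y') - (g c - be * c + be * pt x' y')) <= e' * (2 * h * K).
  move=> _ _ hx hy.
  have vecE : pt x' y' - c = vec (x' - l1) (y' - l2) by rewrite !rmorphB /c /=; ring.
  have small : nrm (pt x' y' - c) <= 2 * h * K by rewrite vecE nrm_vec// mulr_ge0.
  have := hd (pt x' y' - c); rewrite [c + _]addrC subrK.
  have -> : g (pt x' y') - g c - be * (pt x' y' - c) =
    g (pt x' y') - (g c - be * c + be * pt x' y') by ring.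
  move=> hd'; apply: le_trans (hd' _) _.
    by apply: (le_lt_trans small); move: hnd; rewrite ltr_pdivlMr ?mulr_gt0//; lra.
  by rewrite ler_wpM2l// ltW.
set E := e' * (2 * h * K) in near_affine.
have E0 : 0 <= E.
  apply: mulr_ge0; first exact: ltW.
  by apply: mulr_ge0; [apply: mulr_ge0|exact: ltW].
pose A x' y' dx dy := vec dx dy * (g c - be * c + be * pt x' y' + be * vec dx dy / 2).
have SA x' y' dx dy : x n <= x' <= x n + h -> x n <= x' + dx <= x n + h ->
    y n <= y' <= y n + h -> y n <= y' + dy <= y n + h ->
    `|dx| <= h -> `|dy| <= h -> nrm (S x' y' dx dy - A x' y' dx dy) <= h * K * E.
  move=> /andP[? ?] /andP[? ?] /andP[? ?] /andP[? ?] dxh dyh.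
  apply: affine_S => //; try by apply/andP; split; lra.
  move=> x2 y2 ? ? hx hy; apply: near_affine => //.
    by move: hx; rewrite !ler_norml => /andP[? ?]; apply/andP; split; lra.
  by move: hy; rewrite !ler_norml => /andP[? ?]; apply/andP; split; lra.
have three (s1 s2 s3 a1 a2 a3 : C) (M : R) : nrm (s1 - a1) <= M ->
    nrm (s2 - a2) <= M -> nrm (s3 - a3) <= M -> a1 + a2 - a3 = 0 ->
    nrm (s1 + s2 - s3) <= 3 * M.
  move=> h1 h2 h3 a0.
  have -> : s1 + s2 - s3 = (s1 - a1) + (s2 - a2) - (s3 - a3).
    by rewrite -[LHS]subr0 -a0; ring.
  have := nrmB ((s1 - a1) + (s2 - a2)) (s3 - a3).
  by have := nrmD (s1 - a1) (s2 - a2); lra.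
have Tn : nrm (T (b n) (x n) (y n) h) <= 3 * (h * K * E).
  have hh : `|h| <= h by rewrite ger0_norm.
  have h00 : `|0 : R| <= h by rewrite normr0.
  have i0 z : z <= z <= z + h by apply/andP; split; lra.
  have ih z : z <= z + h <= z + h by apply/andP; split; lra.
  have i00 z : z <= z + 0 <= z + h by apply/andP; split; lra.
  have ih0 z : z <= z + h + 0 <= z + h by apply/andP; split; lra.
  rewrite /T; case: (b n).
    apply: (three _ _ _ (A (x n) (y n) 0 h) (A (x n) (y n + h) h 0) (A (x n) (y n) h h)).
    - exact: SA.
    - exact: SA.
    - exact: SA.
    - by rewrite /A !rmorphD !rmorph0 /=; field.
  apply: (three _ _ _ (A (x n) (y n) h 0) (A (x n + h) (y n) 0 h) (A (x n) (y n) h h)).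
  - exact: SA.
  - exact: SA.
  - exact: SA.
  - by rewrite /A !rmorphD !rmorph0 /=; field.
apply: (le_trans hT).
have h4 : h * h * 4 ^+ n = 1.
  rewrite /h -exprMn -exprMn -[RHS](expr1n _ n); congr (_ ^+ _).
  by rewrite -mulrA; lra.
apply: (@le_trans _ _ (3 * (h * K * E) * 4 ^+ n)).
  by rewrite ler_pM2r// exprn_gt0.
have -> : 3 * (h * K * E) * 4 ^+ n = (6 * K ^+ 2) * e' * (h * h * 4 ^+ n).
  by rewrite /E; ring.
have K6 : 6 * K ^+ 2 != 0 by apply: lt0r_neq0; rewrite mulr_gt0// exprn_gt0.
by rewrite h4 mulr1 /e' mulrCA divff// mulr1.
Qed.

End Goursat.

(** * Rules for complex differentiability *)

Section PointwiseDifferentiability.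
Context (R : realType).
Local Notation C := (Cx R).

Lemma real_derive_nrm (f : R -> R) (l : R) : is_derive (0 : R) 1 f l ->
  forall e : R, 0 < e -> exists2 d : R, 0 < d &
    forall x, `|x| < d -> `|f x - f 0 - l * x| <= e * `|x|.
Proof.
move=> [df]; rewrite /derive => fl e e0.
have /cvgrPdist_le/(_ e e0) : (fun h => h^-1 *: ((f \o shift 0) (h *: 1) - f 0))
   @ 0^' --> l by rewrite -fl; exact: df.
rewrite near_withinE => /nbhs_ballP[d /= d0 hd]; exists d => // x xd.
have [->|x0] := eqVneq x 0; first by rewrite mulr0 subr0 subrr normr0 mulr0.
have := hd x; rewrite -ball_normE /= sub0r normrN => /(_ xd x0).
rewrite addr0 -[x *: 1]/(x * 1) mulr1 -[_ *: _]/(x^-1 * (f x - f 0)) distrC.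
have -> : f x - f 0 - l * x = (x^-1 * (f x - f 0) - l) * x by field.
by rewrite normrM => h; rewrite ler_wpM2r.
Qed.

(** Stated for lambda-abstractions rather than for the pointwise operations on
    functions, since this is the form of the integrands below. *)
Section Rules.
Variables (V : normedModType C) (x : V).
Implicit Types f g : V -> C.

Lemma diffable_cst (W : normedModType C) (a : W) : differentiable (fun _ : V => a) x.
Proof. exact: differentiable_cst. Qed.

Lemma diffable_id : differentiable (fun y : V => y) x.
Proof. exact: ex_diff. Qed.

Lemma diffableD f g : differentiable f x -> differentiable g x ->
  differentiable (fun y => f y + g y) x.
Proof. exact: differentiableD. Qed.

Lemma diffableB f g : differentiable f x -> differentiable g x ->
  differentiable (fun y => f y - g y) x.
Proof. exact: differentiableB. Qed.

Lemma diffableN f : differentiable f x -> differentiable (fun y => - f y) x.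
Proof. exact: differentiableN. Qed.

Lemma diffableM f g : differentiable f x -> differentiable g x ->
  differentiable (fun y => f y * g y) x.
Proof. exact: differentiableM. Qed.

Lemma diffableV f : differentiable f x -> f x != 0 ->
  differentiable (fun y => (f y)^-1) x.
Proof. exact: differentiableV. Qed.

Lemma diffable_comp (W X : normedModType C) (f : V -> W) (g : W -> X) :
  differentiable f x -> differentiable g (f x) ->
  differentiable (fun y => g (f y)) x.
Proof. exact: differentiable_comp. Qed.

Lemma diffable_pair (W X : normedModType C) (f : V -> W) (g : V -> X) :
  differentiable f x -> differentiable g x ->
  differentiable (fun y => (f y, g y)) x.
Proof. exact: differentiable_pair. Qed.

End Rules.

Lemma diffable_of_estimate (V W : normedModType C) (f L : V -> W) x (k : R) :
  linear L -> (forall h, nrm (L h) <= k * nrm h) ->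
  (forall e : R, 0 < e -> exists2 d : R, 0 < d &
    forall h, nrm h < d -> nrm (f (x + h) - f x - L h) <= e * nrm h) ->
  differentiable f x.
Proof.
move=> lL kL hf.
pose L' : {linear V -> W} := HB.pack L (GRing.isLinear.Build C V W _ L lL).
have [| |//] := @nrm_differentiable R V W f x L'; last exact: hf.
exists (`|k| + 1); first by rewrite ltr_pwDr.
move=> h; apply: (le_trans (kL h)); rewrite ler_wpM2r ?nrm_ge0//.
by rewrite ler_wpDr// ler_norm.
Qed.

Lemma diffable_linear (V W : normedModType C) (f : V -> W) x (k : R) :
  linear f -> (forall h, nrm (f h) <= k * nrm h) -> differentiable f x.
Proof.
move=> lf kf; apply: (diffable_of_estimate lf kf) => e e0.
exists 1 => // h _.
have -> : f (x + h) = f h + f x by rewrite -{1}[h]scale1r addrC lf scale1r.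
by rewrite addrK subrr nrm0 mulr_ge0 ?nrm_ge0// ltW.
Qed.

Lemma diffable_fst (V W : normedModType C) (p : V * W) :
  differentiable (fun q : V * W => q.1) p.
Proof.
apply: (@diffable_linear _ _ _ _ 1) => // h.
by rewrite mul1r nrm_pair le_max lexx.
Qed.

Lemma diffable_snd (V W : normedModType C) (p : V * W) :
  differentiable (fun q : V * W => q.2) p.
Proof.
apply: (@diffable_linear _ _ _ _ 1) => // h.
by rewrite mul1r nrm_pair le_max lexx orbT.
Qed.

Lemma differentiable_near_eq (V W : normedModType C) (f g : V -> W) x :
  (\forall y \near x, f y = g y) -> differentiable f x -> differentiable g x.
Proof.
move=> /nbhs_nrmP[d d0 fg] df.
have [k k0 kb] : exists2 k : R, 0 < k & forall h, nrm ('d f x h) <= k * nrm h.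
  have /linear_bounded_continuous := diff_continuous df.
  move=> /linear_boundedP[k0 [k0r hk]].
  have [M [M0 hM]] : exists M : R, 0 < M /\ k0 < rc M.
    move: k0r => /(@complex_realP R)[k ->]; exists (`|k| + 1); split.
      by rewrite ltr_pwDr.
    by rewrite -[k%:C%C]/(rc k) rc_lt ltr_pwDr// ler_norm.
  exists M => // h; rewrite -rc_le rmorphM /= !rc_nrm; exact: hk.
have [| |//] := @nrm_differentiable R V W g x ('d f x); first by exists k.
move=> e e0; have [d' d'0 hd] := differentiable_nrm df e0.
exists (Num.min d d'); first by rewrite lt_min d0.
move=> h; rewrite lt_min => /andP[h1 h2].
rewrite -!fg ?subrr ?nrm0//; last by rewrite addrC addKr.
exact: hd.
Qed.

End PointwiseDifferentiability.

(** * The complex exponential and the unit circle *)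

Section Exponential.
Context (R : realType).
Local Notation C := (Cx R).

Lemma cexpD (z w : C) : cexp (z + w) = cexp z * cexp w.
Proof.
case: z w => [a b] [c d]; rewrite /cexp /= expRD cosD sinD.
by apply/eqP; rewrite eq_complex /=; apply/andP; split; apply/eqP; ring.
Qed.

Lemma cexp0 : cexp (0 : C) = 1.
Proof. by rewrite /cexp /= expR0 cos0 sin0 mulr0 mulr1. Qed.

Lemma cexpN (z : C) : cexp z * cexp (- z) = 1.
Proof. by rewrite -cexpD subrr cexp0. Qed.

Lemma cexp_neq0 (z : C) : cexp z != 0.
Proof.
apply/eqP => z0; have := cexpN z; rewrite z0 mul0r => /esym/eqP.
by rewrite oner_eq0.
Qed.

Lemma nrm_cexp (z : C) : nrm (cexp z) = expR (complex.Re z).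
Proof.
rewrite nrmE /= !exprMn -mulrDr cos2Dsin2 mulr1 sqrtr_sqr ger0_norm// expR_ge0.
Qed.

Lemma cexp_rc (x : R) : cexp (rc x) = rc (expR x).
Proof. by rewrite /cexp /= cos0 sin0 mulr1 mulr0. Qed.

(** By the functional equation the claim reduces to an estimate of
    [cexp h - 1 - h] near 0.  Its real and imaginary parts are controlled by the
    derivatives at 0 of the real exponential, the cosine and the sine. *)
Lemma cexp_differentiable (z : C) :
  differentiable (@cexp R) z /\ 'd (@cexp R) z 1 = cexp z.
Proof.
apply: nrm1_differentiable => e e0.
(* The error terms collected at the end add up to [6 * E1 * n]. *)
set E := e / (nrm (cexp z) * 8).
have z0 : 0 < nrm (cexp z) by rewrite nrm_cexp expR_gt0.
have E0 : 0 < E by rewrite divr_gt0// mulr_gt0.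
pose E1 := Num.min E 1.
have E10 : 0 < E1 by rewrite lt_min E0 ltr01.
have E11 : E1 <= 1 by rewrite ge_min lexx orbT.
have [d1 d10 h1] := @real_derive_nrm R expR _ (is_derive_expR 0) _ E10.
have [d2 d20 h2] := @real_derive_nrm R sin _ (is_derive_sin 0) _ E10.
have [d3 d30 h3] := @real_derive_nrm R cos _ (is_derive_cos 0) _ E10.
exists (Num.min (Num.min d1 d2) (Num.min d3 (E1 / 2))).
  by rewrite !lt_min d10 d20 d30 divr_gt0.
move=> h; rewrite !lt_min => /andP[/andP[hd1 hd2] /andP[hd3 hE]].
have -> : cexp (z + h) - cexp z - cexp z * h = cexp z * (cexp h - 1 - h).
  by rewrite cexpD; ring.
rewrite nrmM.
have ha := nrm_Re h; have hb := nrm_Im h.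
have A1 := h1 _ (le_lt_trans ha hd1).
have A2 := h2 _ (le_lt_trans hb hd2).
have A3 := h3 _ (le_lt_trans hb hd3).
have hn := nrm_ge0 h; set n := nrm h in ha hb hE hn *.
suff : nrm (cexp h - 1 - h) <= E * 8 * n.
  move=> H; apply: (le_trans (ler_wpM2l (ltW z0) H)).
  by rewrite /E mulrA [X in X <= _](_ : _ = e * n)//; field; rewrite gt_eqF.
apply: (@le_trans _ _ (E1 * 8 * n)); last first.
  by rewrite !ler_wpM2r// ge_min lexx.
clear hd1 hd2 hd3 h1 h2 h3; apply: (le_trans (nrm_ReIm _)).
move: A1 A2 A3 ha hb; case: h @n hE hn => a b n hE hn /=.
rewrite expR0 sin0 cos0 !mul1r !subr0 oppr0 mul0r subr0 => A1 A2 A3 ha hb.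
set x := expR a in A1 *; set s := sin b in A2 *; set c := cos b in A3 *.
have B1 : `|x - 1 - a| <= E1 * n by apply: le_trans A1 _; rewrite ler_pM2l.
have B2 : `|s - b| <= E1 * n by apply: le_trans A2 _; rewrite ler_pM2l.
have B3 : `|c - 1| <= E1 * n by apply: le_trans A3 _; rewrite ler_pM2l.
have x1 : `|x - 1| <= E1.
  have -> : x - 1 = (x - 1 - a) + a by ring.
  apply: (le_trans (ler_normD _ _)).
  have : E1 * n <= E1 / 2 by rewrite ler_pM2l//; lra.
  by lra.
have x2 : `|x| <= 2.
  have -> : x = (x - 1) + 1 by ring.
  by apply: (le_trans (ler_normD _ _)); rewrite normr1; lra.
have -> : x * c - 1 - a = (x - 1 - a) + x * (c - 1) by ring.
rewrite ?subr0 ?addr0.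
have -> : x * s - b = x * (s - b) + (x - 1) * b by ring.
have P1 : `|x * (c - 1)| <= 2 * (E1 * n) by rewrite normrM ler_pM.
have P2 : `|x * (s - b)| <= 2 * (E1 * n) by rewrite normrM ler_pM.
have P3 : `|(x - 1) * b| <= E1 * n by rewrite normrM ler_pM.
have N1 := ler_normD (x - 1 - a) (x * (c - 1)).
have N2 := ler_normD (x * (s - b)) ((x - 1) * b).
have := mulr_ge0 (ltW E10) hn; lra.
Qed.

Lemma diffable_cexp (z : C) : differentiable (@cexp R) z.
Proof. by case: (cexp_differentiable z). Qed.

(** [2 * pi * i], the period of the exponential. *)
Definition tau : C := Complex 0 (pi *+ 2).

Definition circle (t : C) : C := cexp (tau * t).

Lemma tau_neq0 : tau != 0.
Proof.
by rewrite eq_complex /= eqxx /= mulrn_eq0 /= gt_eqF// pi_gt0.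
Qed.

Lemma cexp_tau : cexp tau = 1.
Proof. by rewrite /cexp /= expR0 cos2pi sin2pi mulr1 mulr0. Qed.

Lemma diffable_circle (V : normedModType C) (f : V -> C) x : differentiable f x ->
  differentiable (fun y => circle (f y)) x.
Proof.
move=> df; apply: (diffable_comp _ (diffable_cexp _)).
by apply: diffableM df; exact: diffable_cst.
Qed.

Lemma nrm_circle t : unit_segment t -> nrm (circle t) = 1.
Proof.
by move=> [x _ <-]; rewrite nrm_cexp /= mulr0 mul0r subr0 expR0.
Qed.

Lemma circle_neq0 t : circle t != 0.
Proof. exact: cexp_neq0. Qed.

End Exponential.

(** * Cauchy's formula with a removable centre *)

Section Cauchy.
Context (R : realType).
Local Notation C := (Cx R).
Implicit Types (f : C -> C) (z : C) (r : R).

Definition circle_mean f r : C := segment_integral (fun t => f (rc r * circle t)).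

Lemma nrm_circle_pt r t : 0 <= r -> unit_segment t -> nrm (rc r * circle t) = r.
Proof. by move=> r0 It; rewrite nrmM nrm_rc nrm_circle// mulr1 ger0_norm. Qed.

Lemma nrm_rev (z w : C) : `|nrm z - nrm w| <= nrm (z - w).
Proof.
rewrite ler_norml; apply/andP; split.
  by have := nrmD (w - z) z; rewrite subrK nrm_distC; lra.
by have := nrmD (z - w) w; rewrite subrK; lra.
Qed.

Lemma continuous_circle_pt f (u t : C) : {for u * circle t, continuous f} ->
  {for (t, u), continuous (fun p : C * C => f (p.2 * circle p.1))}.
Proof.
move=> cf.
apply: (@continuous_comp _ _ _ (fun p : C * C => p.2 * circle p.1) f); last exact: cf.
apply: differentiable_continuous; apply: diffableM; first exact: diffable_snd.
by apply: diffable_circle; exact: diffable_fst.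
Qed.

Lemma segment_continuous_circle f r : 0 <= r ->
  (forall z, nrm z = r -> {for z, continuous f}) ->
  segment_continuous (fun t => f (rc r * circle t)).
Proof.
move=> r0 cf; split=> t It.
apply: (@continuous_comp _ _ _ (fun t => rc r * circle t) f).
  apply: differentiable_continuous; apply: diffableM; first exact: diffable_cst.
  by apply: diffable_circle; exact: diffable_id.
by apply: cf; exact: nrm_circle_pt.
Qed.

Lemma circle_mean_continuous f r (d : R) : 0 < d -> 0 <= r ->
  (forall z, `|nrm z - r| < d -> {for z, continuous f}) ->
  forall e : R, 0 < e -> exists2 d' : R, 0 < d' &
    forall r', `|r' - r| < d' -> nrm (circle_mean f r' - circle_mean f r) < e.
Proof.
move=> d0 r0 cf.
have : {for rc r, continuous (fun u : C => segment_integral (fun t => f (u * circle t)))}.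
  apply: (@segment_integral_continuous R C (rc r) (fun p => f (p.2 * circle p.1))).
  exists d => // t u It ud.
  apply: continuous_circle_pt; apply: cf; rewrite nrmM nrm_circle// mulr1.
  by apply: le_lt_trans ud; have := nrm_rev u (rc r); rewrite nrm_rc (ger0_norm r0).
move=> /continuous_nrmP h e /h[d' d'0 hd]; exists d' => // r' hr.
by apply: hd; rewrite -rmorphB nrm_rc.
Qed.

(** In the coordinate [log z] an annulus becomes a strip and two of its circles
    become opposite sides of a rectangle.  The integrals over the other two sides
    cancel by periodicity, so Goursat's lemma, applied to the two triangles of
    the rectangle, says that the two circles have the same mean. *)
Lemma circle_mean_invariant f (r1 r2 r r' : R) :
  (forall z, r1 < nrm z < r2 -> differentiable f z) ->
  0 < r -> 0 < r' -> r1 < r < r2 -> r1 < r' < r2 ->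
  circle_mean f r = circle_mean f r'.
Proof.
move=> df; wlog rr' : r r' / r <= r'.
  move=> W r0 r'0 h h'; have [le|/ltW le] := leP r r'; first exact: W.
  by apply/esym/W.
move=> r0 r'0 /andP[r1r rr2] /andP[r1r' r'r2].
pose a := rc (ln r); pose v := rc (ln r' - ln r); pose w := tau R.
have lnrr' : ln r <= ln r' by rewrite ler_ln.
pose g (z : C) := f (cexp z).
have dg x y : in01 x -> in01 y -> differentiable g (a + rc x * v + rc y * w).
  move=> /andP[x0 x1] _; apply: (diffable_comp (diffable_cexp _)).
  apply: df; rewrite nrm_cexp /= !mul0r mulr0 !subr0 addr0.
  apply/andP; split.
    apply: (lt_le_trans r1r); rewrite -{1}(lnK r0) ler_expR lerDl.
    by rewrite mulr_ge0// subr_ge0.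
  apply: (le_lt_trans _ r'r2); rewrite -{2}(lnK r'0) ler_expR.
  nra.
have T1 : triangle_integral g a v w = 0 by apply: goursat.
have T2 : triangle_integral g a w v = 0.
  by apply: goursat => x y hx hy; rewrite addrAC; exact: dg.
have per : path_integral g (a + w) v = path_integral g a v.
  congr (_ * _); apply: segment_integral_ext => t _.
  rewrite /g /w; have -> : a + tau R + v * t = a + v * t + tau R by ring.
  by rewrite [in LHS]cexpD cexp_tau mulr1.
have : w * segment_integral (fun t => g (a + w * t)) =
       w * segment_integral (fun t => g (a + v + w * t)).
  move: T1 T2; rewrite /triangle_integral per -[path_integral g (a + v) w]/(_ * _).
  rewrite -[path_integral g a w]/(_ * _) [w + v]addrC => T1 T2.
  apply/eqP; rewrite -subr_eq0 -[X in _ == X](subrr (0 : C)) -{1}T2 -T1.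
  by apply/eqP; ring.
move/(mulfI (tau_neq0 R)); rewrite /circle_mean => E.
rewrite (_ : segment_integral _ = segment_integral (fun t => g (a + w * t))).
  rewrite E; apply: segment_integral_ext => t _.
  by rewrite /g cexpD -rmorphD subrKC cexp_rc lnK.
by apply: segment_integral_ext => t _; rewrite /g cexpD cexp_rc lnK.
Qed.

(** The mean does not depend on the radius as long as it exceeds [nrm z], and the
    integrand tends to 1 as the radius grows. *)
Lemma cauchy_kernel_mean z r : nrm z < r ->
  circle_mean (fun u => u / (u - z)) r = 1.
Proof.
move=> zr.
have zpos := nrm_ge0 z.
have dk u : nrm z < nrm u -> differentiable (fun u : C => u / (u - z)) u.
  move=> zu; apply: diffableM; first exact: diffable_id.
  apply: diffableV; last by rewrite subr_eq0; apply: contraTneq zu => ->; rewrite ltxx.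
  by apply: diffableB; [exact: diffable_id|exact: diffable_cst].
have ck s : nrm z < s -> segment_continuous
    (fun t => rc s * circle t / (rc s * circle t - z)).
  move=> zs; apply: (@segment_continuous_circle (fun u => u / (u - z))).
    by rewrite (le_trans _ (ltW zs)).
  by move=> u us; apply: differentiable_continuous; apply: dk; rewrite us.
apply/eqP; rewrite -subr_eq0; apply/eqP/nrm_small => e e0.
(* A radius that makes [nrm z / (s - nrm z)] at most [e]. *)
pose s := nrm z + (nrm z + 1) / e + r.
have ze : 0 < (nrm z + 1) / e by rewrite divr_gt0// ltr_wpDl.
have zs : nrm z < s by rewrite /s; lra.
have -> : circle_mean (fun u => u / (u - z)) r = circle_mean (fun u => u / (u - z)) s.
  apply: (@circle_mean_invariant _ (nrm z) (s + 1)); first last.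
  - by apply/andP; split; lra.
  - by apply/andP; split; rewrite /s; lra.
  - by lra.
  - by lra.
  - by move=> u /andP[zu _]; exact: dk.
rewrite -(segment_integral_cst 1) -(segment_integralB (ck _ zs) (segment_continuous_cst _)).
apply: nrm_segment_integral.
  by apply: (segment_continuousB (ck _ zs) (segment_continuous_cst _)).
move=> t It; set u := rc s * circle t.
have us : nrm u = s by rewrite nrm_circle_pt//; lra.
have uz : s - nrm z <= nrm (u - z).
  by have := nrm_rev u z; rewrite us ler_norml => /andP[_]; lra.
have uz0 : u - z != 0 by rewrite -nrm_eq0 gt_eqF//; lra.
have -> : u / (u - z) - 1 = z / (u - z) by field.
rewrite nrmM nrmV ler_pdivrMr; last by lra.
apply: (@le_trans _ _ (e * (s - nrm z))); last by rewrite ler_pM2l.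
rewrite /s; have -> : e * (nrm z + (nrm z + 1) / e + r - nrm z) = nrm z + 1 + e * r.
  by field; rewrite gt_eqF.
by have := mulr_gt0 e0 (le_lt_trans zpos zr); lra.
Qed.

(** The means of [h u = u * (f u - f z) / (u - z)] vanish.  Indeed they are
    constant for radii below [nrm z] and tend to 0 with the radius, because [f]
    is bounded near 0; they are constant for radii above [nrm z]; and they are
    continuous in the radius at [nrm z], because [h] extends continuously to [z].
    The centre 0 may be a singularity, so this contains Riemann's theorem on
    removable singularities. *)
Lemma cauchy_formula_punctured f z (r rho : R) :
  (forall u, 0 < nrm u < rho -> differentiable f u) ->
  (exists d M : R, 0 < d /\ forall u, 0 < nrm u < d -> nrm (f u) <= M) ->
  z != 0 -> nrm z < r -> r < rho ->
  f z = circle_mean (fun u => f u * (u / (u - z))) r.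
Proof.
move=> df [d [M [d0 fM]]] z0 zr rrho.
have n0 : 0 < nrm z by rewrite nrm_gt0.
pose h (u : C) := (if u == z then 'd f z 1 else (f u - f z) / (u - z)) * u.
have dz : differentiable f z by apply: df; rewrite n0; lra.
have dh u : 0 < nrm u < rho -> u != z -> differentiable h u.
  move=> hu uz.
  have uz0 : 0 < nrm (u - z) by rewrite nrm_gt0 subr_eq0.
  apply: (@differentiable_near_eq _ _ _ (fun u => (f u - f z) / (u - z) * u)).
    apply/nbhs_nrmP; exists (nrm (u - z)) => // y yu; rewrite /h ifN//.
    by apply: contraTneq yu => ->; rewrite nrm_distC ltxx.
  apply: diffableM; last exact: diffable_id.
  apply: diffableM; first by apply: diffableB; [exact: df|exact: diffable_cst].
  apply: diffableV; last by rewrite subr_eq0.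
  by apply: diffableB; [exact: diffable_id|exact: diffable_cst].
have ch u : 0 < nrm u < rho -> {for u, continuous h}.
  move=> hu; have [->|uz] := eqVneq u z; last exact/differentiable_continuous/dh.
  apply: continuousM; last exact/differentiable_continuous/diffable_id.
  apply/continuous_nrmP => e e0.
  have e2 : 0 < e / 2 by rewrite divr_gt0.
  have [d1 d10 hd1] := differentiable_nrm1 dz e2.
  exists d1 => // y yz; rewrite eqxx; case: eqP => [_|/eqP ynz].
    by rewrite subrr nrm0.
  have ynz0 : y - z != 0 by rewrite subr_eq0.
  have := hd1 _ yz; rewrite [z + _]addrC subrK => H.
  have -> : (f y - f z) / (y - z) - 'd f z 1 =
    (f y - f z - 'd f z 1 * (y - z)) / (y - z) by field.
  rewrite nrmM nrmV ltr_pdivrMr ?nrm_gt0//; apply: (le_lt_trans H).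
  by rewrite ltr_pM2r ?nrm_gt0//; lra.
have small (s : R) : 0 < s -> s < d -> s < nrm z / 2 ->
    nrm (circle_mean h s) <= (M + nrm (f z)) / (nrm z / 2) * s.
  move=> s0 sd sz; apply: nrm_segment_integral.
    apply: segment_continuous_circle; first exact: ltW.
    by move=> u us; apply: ch; rewrite us s0; lra.
  move=> t It; set u := rc s * circle t.
  have us : nrm u = s by rewrite nrm_circle_pt// ltW.
  have uz : nrm z / 2 <= nrm (u - z).
    by have := nrm_rev u z; rewrite us ler_norml => /andP[]; lra.
  have uz0 : u == z = false by rewrite -subr_eq0 -nrm_eq0 gt_eqF//; lra.
  rewrite /h uz0 nrmM us ler_pM2r// nrmM nrmV.
  have fu : nrm (f u) <= M by apply: fM; rewrite us s0.
  apply: ler_pM => //; rewrite ?nrm_ge0 ?invr_ge0 ?nrm_ge0//.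
    by apply: (le_trans (nrmB _ _)); rewrite lerD2r.
  by rewrite lef_pV2// ?posrE//; lra.
have inner (s : R) : 0 < s -> s < nrm z -> circle_mean h s = 0.
  move=> s0 sz; apply: nrm_small => e e0.
  have M0 : 0 <= M.
    apply: le_trans (fM (rc (d / 2)) _); first exact: nrm_ge0.
    by rewrite nrm_rc gtr0_norm ?divr_gt0//; apply/andP; split; lra.
  set A := (M + nrm (f z)) / (nrm z / 2) + 1.
  have A0 : 0 < A by rewrite ltr_wpDl// divr_ge0 ?addr_ge0 ?nrm_ge0//; lra.
  pose s' := Num.min (Num.min (d / 2) (nrm z / 3)) (e / A).
  have s'0 : 0 < s' by rewrite !lt_min !divr_gt0.
  have s'd : s' < d by rewrite !gt_min; apply/orP; left; apply/orP; left; lra.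
  have s'z : s' < nrm z / 2.
    by rewrite !gt_min; apply/orP; left; apply/orP; right; lra.
  have -> : circle_mean h s = circle_mean h s'.
    apply: (@circle_mean_invariant _ 0 (nrm z)); [|exact: s0|exact: s'0| |].
    - move=> u /andP[u0 uz]; apply: dh; first by rewrite u0; lra.
      by apply: contraTneq uz => ->; rewrite ltxx.
    - by rewrite s0.
    - by rewrite s'0; lra.
  apply: (le_trans (small _ s'0 s'd s'z)).
  apply: (@le_trans _ _ (A * s')); first by rewrite ler_wpM2r ?(ltW s'0)// lerDl.
  by rewrite mulrC -ler_pdivlMr// /s' !ge_min lexx !orbT.
have cont (e : R) : 0 < e -> exists2 d' : R, 0 < d' & forall r', `|r' - nrm z| < d' ->
    nrm (circle_mean h r' - circle_mean h (nrm z)) < e.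
  apply: (@circle_mean_continuous h (nrm z) (Num.min (nrm z) (rho - nrm z))).
  - by rewrite lt_min n0; lra.
  - exact: ltW.
  - move=> u; rewrite lt_min !ltr_norml => /andP[/andP[? ?] /andP[? ?]].
    by apply: ch; apply/andP; split; lra.
have mid : circle_mean h (nrm z) = 0.
  apply: nrm_small => e e0; have [d' d'0 hd] := cont _ e0.
  pose s := Num.max (nrm z / 2) (nrm z - d' / 2).
  have sz : s < nrm z by rewrite gt_max; apply/andP; split; lra.
  have sz' : nrm z - d' / 2 <= s by rewrite le_max lexx orbT.
  have s0 : 0 < s by rewrite lt_max; apply/orP; left; lra.
  have := hd s; rewrite inner// sub0r nrmN => H; apply/ltW/H.
  by rewrite ltr_norml; apply/andP; split; lra.
have outer : circle_mean h r = 0.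
  apply: nrm_small => e e0; have [d' d'0 hd] := cont _ e0.
  pose s := Num.min r (nrm z + d' / 2).
  have sz : nrm z < s by rewrite lt_min; apply/andP; split; lra.
  have sz' : s <= nrm z + d' / 2 by rewrite ge_min lexx orbT.
  have sr : s <= r by rewrite ge_min lexx.
  have -> : circle_mean h r = circle_mean h s.
    apply: (@circle_mean_invariant _ (nrm z) rho); first last.
    - by apply/andP; split; lra.
    - by apply/andP; split; lra.
    - by lra.
    - by lra.
    - move=> u /andP[u0 uz]; apply: dh; first by rewrite uz; lra.
      by apply: contraTneq u0 => ->; rewrite ltxx.
  have := hd s; rewrite mid subr0 => H; apply/ltW/H.
  by rewrite ltr_norml; apply/andP; split; lra.
have r0 : 0 < r by lra.
have rk u : nrm u = r -> u - z != 0.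
  by move=> ur; rewrite subr_eq0; apply: contraTneq zr => <-; rewrite ur ltxx.
have cK : segment_continuous (fun t => rc r * circle t / (rc r * circle t - z)).
  apply: (@segment_continuous_circle (fun u => u / (u - z)) _ (ltW r0)) => u ur.
  apply: differentiable_continuous; apply: diffableM; first exact: diffable_id.
  by apply: diffableV; [apply: diffableB; [exact: diffable_id|exact: diffable_cst]|exact: rk].
have cf : segment_continuous (fun t => f (rc r * circle t)).
  apply: (segment_continuous_circle (ltW r0)) => u ur.
  by apply: differentiable_continuous; apply: df; rewrite ur r0.
have := outer; rewrite /circle_mean.
rewrite (@segment_integral_ext _ _ (fun t => f (rc r * circle t) *
   (rc r * circle t / (rc r * circle t - z)) -
   f z * (rc r * circle t / (rc r * circle t - z)))); last first.
  move=> t It; set u := rc r * circle t.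
  have /rk uz : nrm u = r by rewrite nrm_circle_pt// ltW.
  have uz' : (u == z) = false by rewrite -subr_eq0; exact: negbTE.
  have alg (A B k x : C) : (A - B) * k * x = A * (x * k) - B * (x * k) by ring.
  by rewrite /h uz'; exact: alg.
rewrite (segment_integralB (segment_continuousM cf cK)
  (segment_continuousM (segment_continuous_cst _) cK)).
rewrite (segment_integralZ _ cK).
have := cauchy_kernel_mean zr; rewrite /circle_mean => ->.
by rewrite mulr1 => /eqP; rewrite subr_eq0 => /eqP.
Qed.

End Cauchy.

(** * Second-order Taylor estimates *)

Section Taylor.
Context (R : realType).
Local Notation C := (Cx R).
Implicit Types (f : C -> C) (z : C) (r : R).

(** Cauchy's formula combined with
    [u / (u - z) = 1 + z / u + z ^ 2 / (u * (u - z))]. *)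
Lemma taylor_punctured f z (r rho M : R) :
  (forall u, 0 < nrm u < rho -> differentiable f u) ->
  (exists d M : R, 0 < d /\ forall u, 0 < nrm u < d -> nrm (f u) <= M) ->
  z != 0 -> 0 < r -> nrm z <= r / 2 -> r < rho ->
  (forall t, unit_segment t -> nrm (f (rc r * circle t)) <= M) ->
  nrm (f z - circle_mean f r - circle_mean (fun u => f u / u) r * z)
    <= 2 * M * (nrm z / r) ^+ 2.
Proof.
move=> df bf z0 r0 zr rrho fM.
have zr' : nrm z < r by lra.
rewrite (cauchy_formula_punctured df bf z0 zr' rrho) /circle_mean.
have dfu u : nrm u = r -> differentiable f u by move=> ur; apply: df; rewrite ur r0.
have u0 u : nrm u = r -> u != 0 by move=> ur; rewrite -nrm_eq0 ur gt_eqF.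
have uz u : nrm u = r -> u - z != 0.
  by move=> ur; rewrite subr_eq0; apply: contraTneq zr' => <-; rewrite ur ltxx.
have dV u : nrm u = r -> differentiable (fun u : C => u^-1) u.
  by move=> ur; apply: diffableV; [exact: diffable_id|exact: u0].
have dVz u : nrm u = r -> differentiable (fun u : C => (u - z)^-1) u.
  move=> ur; apply: diffableV; last exact: uz.
  by apply: diffableB; [exact: diffable_id|exact: diffable_cst].
have cont (k : C -> C) : (forall u, nrm u = r -> differentiable k u) ->
    segment_continuous (fun t => k (rc r * circle t)).
  move=> dk; apply: (segment_continuous_circle (ltW r0)) => u ur.
  exact/differentiable_continuous/dk.
have c1 := cont (fun u => f u * (u / (u - z)))
  (fun u ur => diffableM (dfu u ur) (diffableM (diffable_id u) (dVz u ur))).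
have c2 := cont f dfu.
have c3 := cont (fun u => f u / u) (fun u ur => diffableM (dfu u ur) (dV u ur)).
rewrite -(segment_integralB c1 c2) [X in _ - X]mulrC -(segment_integralZ _ c3).
have c4 := segment_continuousB c1 c2.
have c5 := segment_continuousM (segment_continuous_cst z) c3.
rewrite -(segment_integralB c4 c5).
apply: nrm_segment_integral; first exact: (segment_continuousB c4 c5).
move=> t It; set u := rc r * circle t.
have ur : nrm u = r by rewrite nrm_circle_pt// ltW.
have alg (F x y : C) : x != 0 -> x - y != 0 ->
    F * (x / (x - y)) - F - y * (F / x) = F * (y * y / (x * (x - y))).
  by move=> x0 xy; field; rewrite x0 xy.
rewrite alg; [|exact: u0|exact: uz].
rewrite !nrmM nrmV nrmM ur.
have uz2 : r / 2 <= nrm (u - z).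
  by have := nrm_rev u z; rewrite ur ler_norml => /andP[]; lra.
have fu := fM t It.
have M0 : 0 <= M := le_trans (nrm_ge0 _) fu.
apply: (@le_trans _ _ (M * (nrm z * nrm z / (r * (r / 2))))); last first.
  by rewrite expr2 [leLHS](_ : _ = 2 * M * (nrm z / r * (nrm z / r)))//; field; rewrite gt_eqF.
apply: ler_pM => //; first exact: nrm_ge0.
  rewrite divr_ge0 ?mulr_ge0 ?nrm_ge0//; exact: ltW.
rewrite ler_wpM2l ?mulr_ge0 ?nrm_ge0// lef_pV2 ?posrE ?mulr_gt0//; first by rewrite ler_pM2l.
by lra.
Qed.

(** For a function differentiable at the centre too, the two coefficients of
    [taylor_punctured] are its value and its derivative at 0. *)
Lemma taylor_disc f (r rho M : R) : 0 < r -> r < rho ->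
  (forall u, nrm u < rho -> differentiable f u) ->
  (forall t, unit_segment t -> nrm (f (rc r * circle t)) <= M) ->
  [/\ f 0 = circle_mean f r,
      'd f 0 1 = circle_mean (fun u => f u / u) r,
      nrm ('d f 0 1 : C) <= M / r &
      forall z, nrm z <= r / 2 ->
        nrm (f z - f 0 - 'd f 0 1 * z) <= 2 * M * (nrm z / r) ^+ 2].
Proof.
move=> r0 rrho df fM.
have d0 : differentiable f 0 by apply: df; rewrite nrm0; lra.
have c0 := differentiable_continuous d0.
have bf : exists d M : R, 0 < d /\ forall u, 0 < nrm u < d -> nrm (f u) <= M.
  have /continuous_nrmP/(_ 1 ltr01)[d d0' hd] := c0.
  exists d, (1 + nrm (f 0)); split=> // u /andP[_ ud].
  have -> : f u = (f u - f 0) + f 0 by rewrite subrK.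
  by apply: (le_trans (nrmD _ _)); rewrite lerD2r ltW// hd// subr0.
have df' u : 0 < nrm u < rho -> differentiable f u by move=> /andP[_ ?]; exact: df.
have T z : z != 0 -> nrm z <= r / 2 ->
    nrm (f z - circle_mean f r - circle_mean (fun u => f u / u) r * z)
      <= 2 * M * (nrm z / r) ^+ 2.
  by move=> z0 zr; exact: (taylor_punctured df' bf z0 r0 zr rrho fM).
set m0 := circle_mean f r in T *; set m1 := circle_mean _ r in T *.
have M0 : 0 <= M := le_trans (nrm_ge0 _) (fM _ (unit_segment0 R)).
have K0 : 0 <= 2 * M / r ^+ 2 by rewrite divr_ge0 ?exprn_ge0 ?mulr_ge0// ltW.
have T' z : z != 0 -> nrm z <= r / 2 ->
    nrm (f z - m0 - m1 * z) <= 2 * M / r ^+ 2 * nrm z ^+ 2.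
  move=> z0 zr; apply: (le_trans (T z z0 zr)).
  by rewrite expr_div_n mulrCA mulrC -mulrA [r ^- 2 * _]mulrC mulrA.
have fm0 : f 0 = m0.
  apply/eqP; rewrite -subr_eq0; apply/eqP/nrm_small => e e0.
  have e2 : 0 < e / 2 by rewrite divr_gt0.
  have /continuous_nrmP/(_ _ e2)[d d0' hd] := c0.
  set A := nrm m1 + 2 * M / r ^+ 2 + 1.
  have A0 : 0 < A by rewrite /A; have := nrm_ge0 m1; lra.
  pose s := Num.min (Num.min (d / 2) (r / 2)) (Num.min 1 (e / 2 / A)).
  have s0 : 0 < s by rewrite !lt_min ltr01 !divr_gt0.
  have s1 : s <= 1 by rewrite !ge_min lexx !orbT.
  have sd : s < d by rewrite !gt_min; apply/orP; left; apply/orP; left; lra.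
  have sr : s <= r / 2 by rewrite !ge_min lexx !orbT.
  have sA : s <= e / 2 / A by rewrite !ge_min lexx !orbT.
  have ns : nrm (rc s) = s by rewrite nrm_rc gtr0_norm.
  have z0 : rc s != 0 by rewrite -nrm_eq0 ns gt_eqF.
  have h1 := T' _ z0; rewrite ns in h1; have {}h1 := h1 sr.
  have h2 := hd (rc s); rewrite subr0 ns in h2; have {}h2 := h2 sd.
  have -> : f 0 - m0 = - (f (rc s) - f 0) + ((f (rc s) - m0 - m1 * rc s) + m1 * rc s).
    by ring.
  apply: (le_trans (nrmD _ _)); rewrite nrmN.
  apply: (le_trans (lerD (ltW h2) (nrmD _ _))).
  rewrite nrmM ns [leRHS]splitr lerD2l.
  have : A * s <= e / 2 by rewrite mulrC -ler_pdivlMr.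
  apply: le_trans; apply: (le_trans (lerD h1 (lexx _))).
  rewrite /A; set a := 2 * M / _ in K0 *.
  have : a * s ^+ 2 <= a * s by rewrite ler_wpM2l// expr2 ler_piMr// ltW.
  by have := ltW s0; nra.
have dm1 : 'd f 0 1 = m1.
  have [|_ //] := @nrm1_differentiable R f 0 m1.
  move=> e e0; set A := 2 * M / r ^+ 2 + 1.
  have A0 : 0 < A by rewrite /A; lra.
  exists (Num.min (r / 2) (e / A)); first by rewrite lt_min !divr_gt0.
  move=> h; rewrite lt_min add0r => /andP[hr hA].
  have [->|h0] := eqVneq h 0; first by rewrite mulr0 subrr subr0 nrm0 mulr0.
  rewrite fm0; apply: (le_trans (T' _ h0 (ltW hr))).
  rewrite expr2 mulrA ler_wpM2r ?nrm_ge0//.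
  have : nrm h * A <= e by rewrite -ler_pdivlMr// ltW.
  by rewrite /A; have := nrm_ge0 h; lra.
split; [exact: fm0|exact: dm1| |].
- rewrite dm1; apply: nrm_segment_integral.
    apply: (@segment_continuous_circle _ (fun u => f u / u) _ (ltW r0)) => u ur.
    apply: differentiable_continuous; apply: diffableM; first by apply: df; rewrite ur.
    by apply: diffableV; [exact: diffable_id|rewrite -nrm_eq0 ur gt_eqF].
  move=> t It; rewrite nrmM nrmV nrm_circle_pt ?(ltW r0)//.
  by rewrite ler_wpM2r ?invr_ge0 ?(ltW r0)//; exact: fM.
- move=> z zr; have [->|z0] := eqVneq z 0.
    by rewrite subrr mulr0 subr0 nrm0 mul0r expr0n /= mulr0.
  by rewrite fm0 dm1; exact: T.
Qed.

End Taylor.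

(** * Entire functions with an entire inverse *)

Section EntireAutomorphisms.
Context (R : realType).
Local Notation C := (Cx R).

Lemma circle_bounded (f : C -> C) (r : R) : 0 <= r ->
  (forall u, nrm u = r -> {for u, continuous f}) ->
  exists2 M : R, 0 <= M & forall t, unit_segment t -> nrm (f (rc r * circle t)) <= M.
Proof.
move=> r0 cf; have [ct] := segment_continuous_circle r0 cf.
exact: (unit_segment_bounded ct).
Qed.

(** The bound on the disc of radius [r] comes from the Taylor estimate on the
    circle of radius [2 * r], which is the image of a compact segment. *)
Lemma entire_bounded_disc (f : C -> C) (r : R) : 0 < r ->
  (forall u, differentiable f u) ->
  exists M : R, forall u, nrm u <= r -> nrm (f u) <= M.
Proof.
move=> r0 df.
have [M M0 hM] : exists2 M : R, 0 <= M &
    forall t, unit_segment t -> nrm (f (rc (2 * r) * circle t)) <= M.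
  apply: circle_bounded; first by rewrite mulr_ge0// ltW.
  by move=> u _; exact/differentiable_continuous/df.
have r20 : 0 < 2 * r by rewrite mulr_gt0.
have r2 : 2 * r < 2 * r + 1 by lra.
have [_ _ D H] := taylor_disc r20 r2 (fun u _ => df u) hM.
exists (nrm (f 0) + M / (2 * r) * r + 2 * M) => u ur.
have -> : f u = f 0 + 'd f 0 1 * u + (f u - f 0 - 'd f 0 1 * u) by ring.
apply: (le_trans (nrmD _ _)); apply: lerD.
  apply: (le_trans (nrmD _ _)); rewrite lerD2l nrmM; apply: ler_pM => //.
    exact: nrm_ge0.
  exact: nrm_ge0.
have hu : nrm u <= 2 * r / 2 by rewrite mulrAC divff ?pnatr_eq0// mul1r.
apply: (le_trans (H u hu)); rewrite -[leRHS]mulr1 ler_wpM2l ?mulr_ge0//.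
rewrite exprn_ile1 ?divr_ge0 ?nrm_ge0 ?(ltW r20)// ler_pdivrMr// mul1r.
by lra.
Qed.

(** Liouville's theorem for linear growth: the coefficients of
    [taylor_punctured] do not depend on the radius [r], and the remainder is of
    order [1 / r]. *)
Lemma liouville_linear_growth (f : C -> C) (B : R) :
  (forall u, u != 0 -> differentiable f u) ->
  (exists d M : R, 0 < d /\ forall u, 0 < nrm u < d -> nrm (f u) <= M) ->
  (forall u, B <= nrm u -> nrm (f u) <= nrm u) ->
  exists c0 c1 : C, forall u, u != 0 -> f u = c0 + c1 * u.
Proof.
move=> df bf gf.
exists (circle_mean f 1), (circle_mean (fun u => f u / u) 1) => z z0.
apply/eqP; rewrite -subr_eq0; apply/eqP/nrm_small => e e0.
have n0 : 0 < nrm z by rewrite nrm_gt0.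
(* A radius for which the remainder [2 * nrm z ^ 2 / r] is at most [e]. *)
pose r := `|B| + 2 * nrm z + 2 * nrm z ^+ 2 / e + 1.
have B0 : B <= `|B| by apply: ler_norm.
have B1 : 0 <= `|B| by [].
have q0 : 0 <= 2 * nrm z ^+ 2 / e by rewrite divr_ge0 ?mulr_ge0 ?exprn_ge0 ?nrm_ge0// ltW.
have r0 : 0 < r by rewrite /r; lra.
have inv (g : C -> C) : (forall u, u != 0 -> differentiable g u) ->
    circle_mean g 1 = circle_mean g r.
  move=> dg; apply: (@circle_mean_invariant _ _ 0 (r + 2)); [|exact: ltr01|exact: r0| |].
  - by move=> u /andP[u0 _]; apply: dg; rewrite -nrm_gt0.
  - by rewrite ltr01 /=; lra.
  - by rewrite r0 /=; lra.
rewrite (inv f df) (inv (fun u => f u / u)); last first.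
  move=> u u0; apply: diffableM; first exact: df.
  by apply: diffableV; [exact: diffable_id|].
rewrite opprD addrA.
have dfr u : 0 < nrm u < r + 1 -> differentiable f u.
  by move=> /andP[u0 _]; apply: df; rewrite -nrm_gt0.
have zr : nrm z <= r / 2 by rewrite /r; lra.
have rr : r < r + 1 by lra.
apply: (le_trans (taylor_punctured (M := r) dfr bf z0 r0 zr rr _)).
  by move=> t It; rewrite -[leRHS](nrm_circle_pt (ltW r0) It) gf// nrm_circle_pt ?(ltW r0)// /r; lra.
have -> : 2 * r * (nrm z / r) ^+ 2 = 2 * nrm z ^+ 2 / r by field; rewrite gt_eqF.
rewrite ler_pdivrMr// [leRHS]mulrC -ler_pdivrMr// /r; lra.
Qed.

(** Let [F] be [f] translated so that its only zero is 0.  Since the inverse [k]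
    is bounded on the unit disc, [nrm (F w) > 1] outside a bounded set, so
    [phi w = w / F w] grows at most linearly; it is bounded near 0 because [k] is
    differentiable at 0.  Hence [phi] is affine off 0 by Liouville's theorem.  It
    has no zero off 0 and [f] is injective, so [phi] is constant. *)
Lemma entire_automorphism_affine (f k : C -> C) :
  (forall u, differentiable f u) -> (forall u, differentiable k u) ->
  cancel f k -> cancel k f -> forall w, f w = f 0 + w * (f 1 - f 0).
Proof.
move=> df dk fk kf.
pose a := k 0; pose F w := f (w + a).
have F0 : F 0 = 0 by rewrite /F add0r kf.
have Fn0 w : w != 0 -> F w != 0.
  apply: contra_neq => Fw0; apply: (addIr a).
  by rewrite add0r -[LHS]fk -/(F w) Fw0.
have dF w : differentiable F w.
  apply: diffable_comp; last exact: df.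
  by apply: diffableD; [exact: diffable_id|exact: diffable_cst].
pose phi w := w / F w.
have phin0 w : w != 0 -> phi w != 0.
  by move=> w0; rewrite mulf_neq0// invr_neq0// Fn0.
have [B hB] := entire_bounded_disc ltr01 dk.
have [c0 [c1 hc]] : exists c0 c1 : C, forall u, u != 0 -> phi u = c0 + c1 * u.
  apply: (@liouville_linear_growth phi (`|B + nrm a| + 1)).
  - move=> u u0; apply: diffableM; first exact: diffable_id.
    by apply: diffableV; [exact: dF|exact: Fn0].
  - have [d d0 hd] := differentiable_nrm1 (dk 0) ltr01.
    have cF := differentiable_continuous (dF 0).
    have /continuous_nrmP/(_ _ d0)[d' d'0 hd'] := cF.
    exists d', (1 + nrm ('d k 0 1 : C)); split=> // w /andP[w0 wd].
    have := hd' w; rewrite subr0 F0 subr0 => /(_ wd) Fd.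
    have := hd _ Fd; rewrite add0r fk -/a addrK mul1r => H.
    rewrite /phi nrmM nrmV ler_pdivrMr ?nrm_gt0 ?Fn0 -?nrm_gt0//.
    have E : w = (w - 'd k 0 1 * F w) + 'd k 0 1 * F w by ring.
    rewrite [X in nrm X <= _]E.
    by apply: (le_trans (nrmD _ _)); rewrite mulrDl mul1r nrmM lerD2r.
  - move=> u hu.
    have u1 : nrm (F u) > 1.
      rewrite ltNge; apply/negP => /hB; rewrite fk => H.
      have := nrmB (u + a) a; rewrite addrK => H2.
      have := ler_norm (B + nrm a); lra.
    rewrite /phi nrmM nrmV ler_pdivrMr ?(lt_trans ltr01)// ler_peMr ?nrm_ge0//.
    exact: ltW.
have hF w : w != 0 -> F w = w / phi w.
  by move=> w0; rewrite /phi invf_div mulrC divfK.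
have c10 : c1 = 0.
  apply/eqP/negPn/negP => c1n; have [c00|c00] := eqVneq c0 0.
    have two0 : (2 : C) != 0 by rewrite pnatr_eq0.
    have : F 1 = F 2.
      rewrite !hF ?oner_eq0// !hc ?oner_eq0// c00 !add0r mulr1.
      by field.
    move=> /(can_inj fk)/addIr/eqP.
    by rewrite -subr_eq0 opprD addrA subrr add0r oppr_eq0 oner_eq0.
  have w0 : - c0 / c1 != 0 by rewrite mulf_neq0 ?oppr_eq0 ?invr_eq0.
  have := phin0 _ w0; rewrite hc// mulrC divfK// subrr.
  by rewrite eqxx.
have hF' w : F w = w / c0.
  have [->|w0] := eqVneq w 0; first by rewrite F0 mul0r.
  by rewrite hF// hc// c10 mul0r addr0.
have ff w : f w = (w - a) / c0 by rewrite -hF' /F subrK.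
by move=> w; rewrite !ff; ring.
Qed.

End EntireAutomorphisms.

(** * Holomorphic dependence of integrals on parameters *)

Section ParameterIntegral.
Context (R : realType).
Local Notation C := (Cx R).
Variables (E : normedModType C) (G : C * E -> C).

(** The derivative of [G (t, _)] at [e0]. *)
Let L (t : C) (e0 h : E) : C := 'd G (t, e0) (0, h).

Let L_linear t e0 : linear (L t e0).
Proof.
move=> a h k; rewrite /L -linearP; congr ('d G (t, e0) _).
by apply/eqP; rewrite xpair_eqE /= scaler0 addr0 !eqxx.
Qed.

Let L0 t e0 : L t e0 0 = 0.
Proof. by rewrite /L -[X in 'd G _ X]/(0 : C * E) linear0. Qed.

Let LZ t e0 c h : L t e0 (c *: h) = c * L t e0 h.
Proof. by have := L_linear t e0 c h 0; rewrite addr0 L0 addr0. Qed.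

(** Cauchy's estimates on the complex line through [e0] in the direction of [h],
    rescaled so that the disc of radius 2 of this line lies in the ball of radius
    [rho]. *)
Lemma slice_estimate t e0 (rho M : R) : 0 < rho ->
  (forall h, nrm h < rho ->
    differentiable G (t, e0 + h) /\ nrm (G (t, e0 + h)) <= M) ->
  (forall h, nrm (L t e0 h) <= 2 * M / rho * nrm h) /\
  (forall h, nrm h <= rho / 4 ->
    nrm (G (t, e0 + h) - G (t, e0) - L t e0 h) <= 8 * M / rho ^+ 2 * nrm h ^+ 2).
Proof.
move=> rho0 hG.
have dG : differentiable G (t, e0).
  by have [] := hG 0; rewrite ?nrm0// addr0.
have key h : h != 0 ->
    nrm (L t e0 h) <= 2 * M / rho * nrm h /\
    (nrm h <= rho / 4 ->
     nrm (G (t, e0 + h) - G (t, e0) - L t e0 h) <= 8 * M / rho ^+ 2 * nrm h ^+ 2).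
  move=> h0; have n0 : 0 < nrm h by rewrite nrm_gt0.
  (* [h = s v] with [nrm v = rho / 2]. *)
  pose s := 2 * nrm h / rho.
  have s0 : 0 < s by rewrite divr_gt0// mulr_gt0.
  pose v := rc s^-1 *: h.
  have hv : h = rc s *: v by rewrite /v scalerA -rmorphM divff ?gt_eqF// rmorph1 scale1r.
  have nv : nrm v = rho / 2.
    rewrite nrmZ nrm_rc gtr0_norm ?invr_gt0// /s.
    by field; rewrite !gt_eqF.
  pose f (u : C) := G (t, e0 + u *: v).
  have vsmall (u : C) : nrm u < 2 -> nrm (u *: v) < rho by rewrite nrmZ nv => ?; nra.
  have daff (u : C) : differentiable (fun u : C => (t, e0 + u *: v)) u.
    apply: diffable_pair; first exact: diffable_cst.
    apply: differentiableD; first exact: differentiable_cst.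
    by apply: differentiableZl; exact: diffable_id.
  have df (u : C) : nrm u < 2 -> differentiable f u.
    move=> u2; apply: diffable_comp; first exact: daff.
    by case: (hG _ (vsmall u u2)).
  have fM (u : C) : unit_segment u -> nrm (f (rc 1 * circle u)) <= M.
    move=> Iu; apply: (proj2 (hG ((rc 1 * circle u) *: v) _)).
    by rewrite nrmZ nrm_circle_pt// nv; lra.
  have df0 : 'd f 0 1 = L t e0 v.
    have [|_ //] := @nrm1_differentiable R f 0 (L t e0 v).
    move=> e e_gt0; have nv0 : 0 < nrm v by rewrite nv divr_gt0.
    have ev : 0 < e / nrm v by rewrite divr_gt0.
    have [d d0 hd] := differentiable_nrm dG ev.
    exists (d / nrm v); first by rewrite divr_gt0.
    move=> u; rewrite ltr_pdivlMr// => ud.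
    have nuv : nrm ((0, u *: v) : C * E) = nrm u * nrm v.
      by rewrite nrm_pair /= nrm0 nrmZ; apply/max_idPr; rewrite mulr_ge0 ?nrm_ge0.
    have := hd (0, u *: v); rewrite nuv => /(_ ud).
    have -> : (t, e0) + (0, u *: v) = (t, e0 + u *: v).
      by apply/eqP; rewrite xpair_eqE /= addr0 !eqxx.
    rewrite -[e / nrm v * _]mulrA [nrm u * _]mulrC mulKf ?gt_eqF//.
    rewrite -[X in _ - _ - X]/(L t e0 (u *: v)) LZ [u * _]mulrC.
    by rewrite /f add0r scale0r addr0.
  have [_ _ D H] := taylor_disc ltr01 (ltr1n R 2) df fM.
  rewrite df0 divr1 in D; rewrite df0 in H.
  split.
    rewrite hv LZ nrmM nrm_rc gtr0_norm// -hv.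
    apply: (le_trans (ler_wpM2l (ltW s0) D)).
    by rewrite /s [leLHS](_ : _ = 2 * M / rho * nrm h)//; field; rewrite gt_eqF.
  move=> hrho; have := H (rc s); rewrite nrm_rc gtr0_norm// => H'.
  have hs : s <= 1 / 2 by rewrite /s ler_pdivrMr//; lra.
  have := H' hs; rewrite /f -hv scale0r addr0 [L t e0 v * _]mulrC -LZ -hv.
  move=> H2; apply: (le_trans H2); rewrite /s divr1.
  by rewrite [leLHS](_ : _ = 8 * M / rho ^+ 2 * nrm h ^+ 2)//; field; rewrite gt_eqF.
split=> h; have [->|h0] := eqVneq h 0.
- by rewrite L0 !nrm0 mulr0.
- by case: (key h h0).
- by rewrite addr0 subrr L0 subr0 !nrm0 expr0n /= mulr0.
- by case: (key h h0).
Qed.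

(** The second-order estimates of [slice_estimate] are uniform on the compact
    segment, so the integral of the derivatives is the derivative of the
    integral.  That the derivatives are continuous in [t] also follows from these
    estimates: they are locally uniform limits of difference quotients. *)
Lemma segment_integral_differentiable (e0 : E) :
  (forall t, unit_segment t -> \forall p \near (t, e0), differentiable G p) ->
  differentiable (fun e => segment_integral (fun t => G (t, e))) e0.
Proof.
move=> nG.
have dG t : unit_segment t -> differentiable G (t, e0) by move=> /nG/nbhs_singleton.
have cG0 t : unit_segment t -> {for (t, e0), continuous G}.
  by move=> It; exact/differentiable_continuous/dG.
have [d d0 hd] : exists2 d : R, 0 < d & forall t e, unit_segment t ->
    nrm (e - e0) < d -> differentiable G (t, e).
  apply: (@unit_segment_tube R E e0 (fun t e => differentiable G (t, e))).
  by move=> t It; have := nG t It; apply: filterS => -[].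
have cGe e : nrm (e - e0) < d -> segment_continuous (fun t => G (t, e)).
  move=> ed; split=> t It.
  apply: (@continuous_comp _ _ _ (fun t : C => (t, e)) G).
    apply: differentiable_continuous; apply: diffable_pair; first exact: diffable_id.
    exact: diffable_cst.
  exact/differentiable_continuous/hd.
have c0 : segment_continuous (fun t => G (t, e0)) by apply: cGe; rewrite subrr nrm0.
have [d1 d10 hd1] := unit_segment_uniform cG0 ltr01.
have [M M0 hM] := unit_segment_bounded (segment_continuousP c0).
pose rho := Num.min d d1.
have rho0 : 0 < rho by rewrite lt_min d0.
have slice t : unit_segment t -> forall h, nrm h < rho ->
    differentiable G (t, e0 + h) /\ nrm (G (t, e0 + h)) <= M + 1.
  move=> It h; rewrite lt_min => /andP[h1 h2]; split.
    by apply: hd => //; rewrite addrC addKr.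
  have -> : G (t, e0 + h) = (G (t, e0 + h) - G (t, e0)) + G (t, e0) by rewrite subrK.
  apply: (le_trans (nrmD _ _)); rewrite addrC; apply: lerD; first exact: hM.
  by apply/ltW/hd1 => //; rewrite addrC addKr.
have cL h : segment_continuous (fun t => L t e0 h).
  split=> t It; apply/continuous_nrmP => e e_gt0.
  have [|h0] := eqVneq h 0.
    move=> ->; exists 1 => // s _.
    by rewrite !L0 subrr nrm0.
  have /nbhs_nrmP[d2 d20 hd2] := nG t It.
  have /continuous_nrmP/(_ 1 ltr01)[d3 d30 hd3] := cG0 t It.
  pose r := Num.min d2 d3.
  have r0 : 0 < r by rewrite lt_min d20.
  have loc s : nrm (s - t) < r -> forall h, nrm h < r ->
      differentiable G (s, e0 + h) /\ nrm (G (s, e0 + h)) <= nrm (G (t, e0)) + 1.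
    move=> st k kr.
    have sm : nrm ((s, e0 + k) - (t, e0) : C * E) < r.
      by rewrite nrm_pair /= gt_max st addrC addKr.
    move: sm; rewrite lt_min => /andP[s2 s3]; split; first exact: hd2.
    have -> : G (s, e0 + k) = (G (s, e0 + k) - G (t, e0)) + G (t, e0) by rewrite subrK.
    apply: (le_trans (nrmD _ _)); rewrite addrC lerD2l ltW//; exact: hd3.
  set M' := nrm (G (t, e0)) + 1 in loc.
  have M'0 : 0 < M' by rewrite ltr_wpDl ?nrm_ge0.
  set K := 8 * M' / r ^+ 2.
  have K0 : 0 < K by rewrite !(divr_gt0, mulr_gt0)// exprn_gt0.
  have n0 : 0 < nrm h by rewrite nrm_gt0.
  (* The step of a difference quotient that approximates [L s e0 h] within
     [e / 4], uniformly for [s] near [t]. *)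
  pose x := Num.min (r / 8 / nrm h) (e / 4 / (K * nrm h ^+ 2)).
  have x0 : 0 < x by rewrite lt_min !divr_gt0// mulr_gt0// exprn_gt0.
  have xr : x * nrm h <= r / 4.
    have : x * nrm h <= r / 8 by rewrite -ler_pdivlMr// ge_min lexx.
    by move/le_trans; apply; lra.
  have xr' : x * nrm h < r.
    by apply: (le_lt_trans xr); lra.
  have xe : K * x * nrm h ^+ 2 <= e / 4.
    have Kn : 0 < K * nrm h ^+ 2 by rewrite mulr_gt0// exprn_gt0.
    have : x <= e / 4 / (K * nrm h ^+ 2) by rewrite /x ge_min lexx orbT.
    by rewrite ler_pdivlMr// mulrA [x * K]mulrC.
  pose D s := G (s, e0 + rc x *: h) - G (s, e0).
  have nxh : nrm (rc x *: h) = x * nrm h by rewrite nrmZ nrm_rc gtr0_norm.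
  have approx s : nrm (s - t) < r -> nrm (D s - rc x * L s e0 h) <= x * (e / 4).
    move=> st; have [_ H] := slice_estimate r0 (loc s st).
    rewrite -LZ; apply: le_trans (H _ _) _; rewrite nxh//.
    rewrite exprMn -/K; have -> : K * (x ^+ 2 * nrm h ^+ 2) = x * (K * x * nrm h ^+ 2).
      by ring.
    by rewrite ler_pM2l.
  have cD : {for t, continuous D}.
    apply: differentiable_continuous; apply: diffableB.
      apply: (@diffable_comp _ _ _ _ _ (fun s : C => (s, e0 + rc x *: h)) G).
        by apply: diffable_pair; [exact: diffable_id|exact: diffable_cst].
      by case: (loc t _ (rc x *: h) _); rewrite ?subrr ?nrm0 ?nxh.
    apply: (@diffable_comp _ _ _ _ _ (fun s : C => (s, e0)) G); last exact: dG.
    by apply: diffable_pair; [exact: diffable_id|exact: diffable_cst].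
  have xe4 : 0 < x * (e / 4) by rewrite mulr_gt0// divr_gt0.
  have /continuous_nrmP/(_ _ xe4)[d4 d40 hd4] := cD.
  exists (Num.min r d4); first by rewrite lt_min r0.
  move=> s; rewrite lt_min => /andP[sr s4].
  rewrite -(ltr_pM2l x0) -[X in X * nrm _](gtr0_norm x0) -nrm_rc -nrmM mulrBr.
  have A1 := approx s sr; have A2 : nrm (D t - rc x * L t e0 h) <= x * (e / 4).
    by apply: approx; rewrite subrr nrm0.
  have A3 := hd4 s s4.
  have alg (p q u v : C) : p - q = - (u - p) + (u - v) + (v - q) by ring.
  rewrite (alg _ _ (D s) (D t)).
  have B1 := nrmD (- (D s - rc x * L s e0 h) + (D s - D t)) (D t - rc x * L t e0 h).
  have B2 := nrmD (- (D s - rc x * L s e0 h)) (D s - D t).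
  rewrite nrmN in B2.
  apply: (le_lt_trans B1); apply: (le_lt_trans (lerD B2 A2)).
  apply: (le_lt_trans (lerD (lerD A1 (ltW A3)) (lexx _))).
  by have := mulr_gt0 x0 e_gt0; clear; lra.
pose H h := segment_integral (fun t => L t e0 h).
have lH : linear H.
  move=> a h k; rewrite /H.
  have -> : a *: segment_integral (fun t => L t e0 h) =
    segment_integral (fun t => a * L t e0 h) by rewrite segment_integralZ.
  rewrite -(segment_integralD (segment_continuousM (segment_continuous_cst a) (cL h)) (cL k)).
  by apply: segment_integral_ext => t _; rewrite L_linear.
apply: (@diffable_of_estimate R _ _ _ H e0 (2 * (M + 1) / rho) lH).
  move=> h; apply: nrm_segment_integral; first exact: cL.
  by move=> t It; have [+ _] := slice_estimate rho0 (slice t It); apply.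
move=> e e_gt0.
set K := 8 * (M + 1) / rho ^+ 2.
have K0 : 0 < K by rewrite divr_gt0 ?exprn_gt0// mulr_gt0// ltr_wpDl.
exists (Num.min (rho / 4) (e / K)).
  by rewrite lt_min (divr_gt0 e_gt0 K0) andbT divr_gt0.
move=> h; rewrite lt_min => /andP[h1 h2].
have hr : nrm (e0 + h - e0) < d.
  have rd : rho <= d by rewrite /rho ge_min lexx.
  rewrite [e0 + h]addrC addrK; apply: (lt_le_trans h1).
  apply: (@le_trans _ _ rho); last exact: rd.
  by rewrite ler_pdivrMr//; lra.
have cdif := segment_continuousB (cGe _ hr) c0.
rewrite -(segment_integralB (cGe _ hr) c0) -(segment_integralB cdif (cL h)).
apply: nrm_segment_integral; first exact: (segment_continuousB cdif (cL h)).
move=> t It; have [_ /(_ h (ltW h1))] := slice_estimate rho0 (slice t It).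
move/le_trans; apply; rewrite expr2 mulrA ler_wpM2r ?nrm_ge0//.
by rewrite mulrC -ler_pdivlMr// ltW.
Qed.

End ParameterIntegral.

(** * Derivatives and primitives in one variable *)

Section DerivativeRules.
Context (R : realType).
Local Notation C := (Cx R).
Variables (f g : C -> C) (x : C).

Lemma derive_mul : differentiable f x -> differentiable g x ->
  'd (fun u => f u * g u) x 1 = f x * 'd g x 1 + g x * 'd f x 1 :> C.
Proof. by move=> df dg; rewrite [X in X _ = _](diffM df dg). Qed.

Lemma derive_opp : differentiable f x ->
  'd (fun u => - f u) x 1 = - 'd f x 1 :> C.
Proof. by move=> df; rewrite [X in X _ = _](diffN df). Qed.

Lemma derive_comp : differentiable f x -> differentiable g (f x) ->
  'd (fun u => g (f u)) x 1 = 'd g (f x) 1 * 'd f x 1 :> C.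
Proof.
move=> df dg; rewrite [X in X _ = _](diff_comp df dg) /= mulrC.
have lin c : 'd g (f x) c = c * 'd g (f x) 1.
  by rewrite -[in LHS](mulr1 c) -[c * 1]/(c *: (1 : C)) linearZ.
exact: lin.
Qed.

End DerivativeRules.

Section Primitives.
Context (R : realType).
Local Notation C := (Cx R).

(** The hypothesis says in epsilon-delta form that the derivative vanishes. *)
Lemma real_derive_zero_cst (f : R -> R) :
  (forall x e, 0 < e -> exists2 d : R, 0 < d &
    forall h, `|h| < d -> `|f (x + h) - f x| <= e * `|h|) ->
  forall x y, f x = f y.
Proof.
move=> hf; suff df (x : R) : is_derive x 1 f 0.
  by move=> x y; exact: (@is_derive_0_is_cst R f x y df).
have cf : (fun h => h^-1 *: ((f \o shift x) (h *: 1) - f x)) @ 0^' --> (0 : R).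
  apply/cvgrPdist_le => e e0; rewrite near_withinE; apply/nbhs_ballP.
  have [d d0 hd] := hf x e e0; exists d => // h; rewrite -ball_normE /= sub0r normrN.
  move=> /hd H h0; rewrite sub0r normrN -[h *: 1]/(h * 1) mulr1 [h + x]addrC.
  by rewrite normrM normfV mulrC ler_pdivrMr ?normr_gt0; [exact: H|exact: h0].
by split; [apply/cvg_ex; exists 0|exact/cvg_lim].
Qed.

(** Apply the real statement to the real and imaginary parts of [f] along the
    line from 0 to [z]. *)
Lemma derive_zero_cst (f : C -> C) :
  (forall z, differentiable f z /\ 'd f z 1 = 0) -> forall z, f z = f 0.
Proof.
move=> df z.
have est (x e : R) : 0 < e -> exists2 d : R, 0 < d & forall h : R, `|h| < d ->
    nrm (f (rc (x + h) * z) - f (rc x * z)) <= e * `|h|.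
  move=> e0; have z1 : 0 < nrm z + 1 by rewrite ltr_wpDl ?nrm_ge0.
  have [dfx dfx0] := df (rc x * z).
  have [|d d0 hd] := differentiable_nrm1 dfx (e := e / (nrm z + 1)).
    by rewrite divr_gt0.
  exists (d / (nrm z + 1)); first by rewrite divr_gt0.
  move=> h; rewrite ltr_pdivlMr// => hh.
  have nh : nrm (rc h * z) <= `|h| * (nrm z + 1).
    by rewrite nrmM nrm_rc ler_wpM2l// lerDl.
  have := hd (rc h * z) (le_lt_trans nh hh).
  rewrite dfx0 mul0r subr0 -mulrDl -rmorphD => H; apply: (le_trans H).
  rewrite -mulrA ler_wpM2l ?(ltW e0)// mulrC ler_pdivrMr//.
apply/eqP; rewrite -subr_eq0; apply/eqP/nrm_small => e e0; apply/ltW.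
have part (g : C -> R) : (forall u v, `|g u - g v| <= nrm (u - v)) -> g (f z) = g (f 0).
  move=> hg; have := @real_derive_zero_cst (fun x => g (f (rc x * z))).
  move=> /(_ _ 1 0); rewrite rmorph1 mul1r rmorph0 mul0r; apply=> x e' e'0.
  have [d d0 hd] := est x e' e'0; exists d => // h /hd.
  exact/le_trans/hg.
have : f z = f 0.
  apply/eqP; rewrite eq_complex; apply/andP; split; apply/eqP; apply: part => u v.
    by rewrite -raddfB; exact: nrm_Re.
  by rewrite -raddfB; exact: nrm_Im.
by move=> ->; rewrite subrr nrm0.
Qed.

(** By Goursat's lemma for the triangle with vertices 0, [z] and [z + h], the
    increment of the primitive is the integral from [z] to [z + h]. *)
Lemma primitive_path_integral (m : C -> C) : (forall z, differentiable m z) ->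
  forall z, differentiable (path_integral m 0) z /\ 'd (path_integral m 0) z 1 = m z.
Proof.
move=> dm z; apply: nrm1_differentiable => e e0.
have /continuous_nrmP/(_ _ e0)[d d0 hd] := differentiable_continuous (dm z).
exists d => // h hh.
have T : triangle_integral m 0 z h = 0 by apply: goursat => x y _ _; exact: dm.
have -> : path_integral m 0 (z + h) - path_integral m 0 z = path_integral m z h.
  move: T; rewrite /triangle_integral add0r => /eqP; rewrite subr_eq0 => /eqP <-.
  by rewrite addrAC subrr add0r.
have cm : segment_continuous (fun t => m (z + h * t)).
  by split=> t _; apply: continuous_comp_affine; exact/differentiable_continuous.
rewrite /path_integral [m z * h]mulrC -mulrBr nrmM mulrC ler_wpM2r ?nrm_ge0//.
rewrite -[X in _ - X](segment_integral_cst (m z)).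
rewrite -(segment_integralB cm (segment_continuous_cst _)).
apply: nrm_segment_integral.
  exact: (segment_continuousB cm (segment_continuous_cst _)).
move=> t It; apply/ltW/hd; rewrite [z + _]addrC addrK nrmM.
apply: le_lt_trans hh; rewrite ler_piMr ?nrm_ge0//; exact: nrm_unit_segment.
Qed.

End Primitives.

(** * Families of holomorphic functions of one variable *)

Section HolomorphicFamilies.
Context (R : realType) (E : normedModType (Cx R)) (U : set E).
Local Notation C := (Cx R).
Hypothesis openU : open U.

Let near_U (e0 : E) : U e0 -> \forall e \near e0, U e.
Proof. by move=> Ue; exact: open_nbhs_nbhs. Qed.

Let near_comp (V W : normedModType C) (f : V -> W) x (P : W -> Prop) :
  differentiable f x -> (\forall y \near f x, P y) -> \forall y \near x, P (f y).
Proof. by move=> /differentiable_continuous; apply. Qed.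

Let near_neq0 (V : normedModType C) (f : V -> C) x :
  differentiable f x -> f x != 0 -> \forall y \near x, f y != 0.
Proof.
move=> df fx; apply: (near_comp (P := fun y => y != 0) df); apply/nbhs_nrmP.
exists (nrm (f x)); first by rewrite nrm_gt0.
by move=> y; apply: contraTneq => ->; rewrite sub0r nrmN ltxx.
Qed.

Let d1 (q : C * (C * E)) : differentiable (fun q : C * (C * E) => q.2.1) q.
Proof. exact: (diffable_comp (diffable_snd q) (diffable_fst q.2)). Qed.

Let d2 (q : C * (C * E)) : differentiable (fun q : C * (C * E) => q.2.2) q.
Proof. exact: (diffable_comp (diffable_snd q) (diffable_snd q.2)). Qed.

Let dc (q : C * (C * E)) : differentiable (fun q : C * (C * E) => circle q.1) q.
Proof. exact: (diffable_circle (diffable_fst q)). Qed.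

(** The derivative of [A] in its first variable, written as a Cauchy integral so
    that its joint differentiability is seen. *)
Definition partial_derivative (A : C * E -> C) (p : C * E) : C :=
  segment_integral (fun t => A (p.1 + circle t, p.2) / circle t).

Section Entire.
Variable A : C * E -> C.
Hypothesis dA : forall p, U p.2 -> differentiable A p.

Let dA1 z e : U e -> differentiable (fun u : C => A (u, e)) z.
Proof.
move=> Ue; apply: (@diffable_comp _ _ _ _ _ (fun u : C => (u, e)) A); last exact: dA.
by apply: diffable_pair; [exact: diffable_id|exact: diffable_cst].
Qed.

Lemma partial_derivativeE z e : U e ->
  'd (fun u : C => A (u, e)) z 1 = partial_derivative A (z, e).
Proof.
move=> Ue; pose f (u : C) := A (z + u, e).
have df u : differentiable f u.
  apply: (@diffable_comp _ _ _ _ _ (fun u : C => z + u) (fun u : C => A (u, e)));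
    last exact: dA1.
  by apply: diffableD; [exact: diffable_cst|exact: diffable_id].
have [M hM] : exists M : R, forall t, unit_segment t -> nrm (f (rc 1 * circle t)) <= M.
  have [c] : segment_continuous (fun t => f (rc 1 * circle t)).
    apply: (segment_continuous_circle ler01) => u _.
    exact: (differentiable_continuous (df u)).
  by have [M _ hM] := unit_segment_bounded c; exists M.
have [_ D _ _] := taylor_disc ltr01 (ltr1n R 2) (fun u _ => df u) hM.
have -> : partial_derivative A (z, e) = 'd f 0 1.
  rewrite D; apply: segment_integral_ext => t _.
  by rewrite /f rmorph1 !mul1r.
have [|_ //] := @nrm1_differentiable R (fun u : C => A (u, e)) z ('d f 0 1).
move=> x x0; have [d d0 hd] := differentiable_nrm1 (df 0) x0.
by exists d => // h /hd; rewrite add0r /f addr0.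
Qed.

Lemma partial_derivative_differentiable p : U p.2 ->
  differentiable (partial_derivative A) p.
Proof.
move=> Up; pose G (q : C * (C * E)) := A (q.2.1 + circle q.1, q.2.2) / circle q.1.
apply: (@segment_integral_differentiable R _ G) => t It.
have : \forall q \near (t, p), U q.2.2 by apply: (near_comp (P := U) (d2 _)); exact: near_U.
apply: filterS => q Uq; apply: diffableM; last first.
  by apply: diffableV; [exact: dc|exact: circle_neq0].
apply: (@diffable_comp _ _ q _ _ (fun q : C * (C * E) => (q.2.1 + circle q.1, q.2.2)) A).
  by apply: diffable_pair; [apply: diffableD; [exact: d1|exact: dc]|exact: d2].
exact: dA.
Qed.

End Entire.

(** With [m] the logarithmic derivative of [A] in the first variable, the
    logarithm is the integral of [m] from 0 to [z], that is [z] times the integral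
    over the unit segment of [m (t * z, e)].  The latter integral is the function
    sought: it depends holomorphically on [(z, e)], also at [z = 0]. *)
Lemma holomorphic_logarithm (A : C * E -> C) :
  (forall p, U p.2 -> differentiable A p) ->
  (forall p, U p.2 -> A p != 0) ->
  (forall e, U e -> A (0, e) = 1) ->
  exists2 al : C * E -> C, (forall p, U p.2 -> differentiable al p) &
    forall p, U p.2 -> A p = cexp (p.1 * al p).
Proof.
move=> dA An0 A1.
pose m (p : C * E) := partial_derivative A p / A p.
have dm p : U p.2 -> differentiable m p.
  move=> Up; apply: diffableM; first exact: partial_derivative_differentiable.
  by apply: diffableV; [exact: dA|exact: An0].
exists (fun p => segment_integral (fun t => m (p.1 * t, p.2))).
  move=> p Up; pose G (q : C * (C * E)) := m (q.2.1 * q.1, q.2.2).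
  apply: (@segment_integral_differentiable R _ G) => t It.
  have : \forall q \near (t, p), U q.2.2 by apply: (near_comp (P := U) (d2 _)); exact: near_U.
  apply: filterS => q Uq.
  apply: (@diffable_comp _ _ q _ _ (fun q : C * (C * E) => (q.2.1 * q.1, q.2.2)) m).
    apply: diffable_pair; last exact: d2.
    by apply: diffableM; [exact: d1|exact: diffable_fst].
  exact: dm.
move=> [z e] /= Ue; pose a (u : C) := A (u, e); pose mu (u : C) := m (u, e).
have dslice (B : C * E -> C) : (forall p, U p.2 -> differentiable B p) ->
    forall u, differentiable (fun u : C => B (u, e)) u.
  move=> dB u; apply: (@diffable_comp _ _ _ _ _ (fun u : C => (u, e)) B); last exact: dB.
  by apply: diffable_pair; [exact: diffable_id|exact: diffable_cst].
have da u : differentiable a u by exact: (dslice A dA).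
have dmu u : differentiable mu u by exact: (dslice m dm).
pose L := path_integral mu 0.
have LE u : L u = u * segment_integral (fun t => m (u * t, e)).
  by congr (_ * _); apply: segment_integral_ext => t _; rewrite add0r.
have [dL dL'] : (forall u, differentiable L u) /\ (forall u, 'd L u 1 = mu u).
  by split=> u; have [] := primitive_path_integral dmu u.
have a1 : a 0 = 1 by exact: A1.
have dal u : 'd a u 1 = partial_derivative A (u, e) by exact: partial_derivativeE.
clearbody L.
pose D (u : C) := a u * cexp (- L u).
have dD u : differentiable D u /\ 'd D u 1 = 0.
  have dNL : differentiable (fun u => - L u) u by exact/diffableN/dL.
  have dcL : differentiable (fun u => cexp (- L u)) u.
    exact: (diffable_comp dNL (diffable_cexp _)).
  split; first exact: (diffableM (da u) dcL).
  have E1 : 'd D u 1 = a u * 'd (fun u => cexp (- L u)) u 1 + cexp (- L u) * 'd a u 1.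
    exact: (derive_mul (da u) dcL).
  have E2 : 'd (fun u => cexp (- L u)) u 1 =
      'd (@cexp R) (- L u) 1 * 'd (fun u => - L u) u 1.
    exact: (derive_comp dNL (diffable_cexp _)).
  have E3 : 'd (fun u => - L u) u 1 = - 'd L u 1 by exact: (derive_opp (dL u)).
  have E4 := proj2 (cexp_differentiable (- L u)).
  have E5 : 'd (fun u => - L u) u 1 = - mu u.
    by apply: (etrans E3); congr (- _); exact: dL'.
  have E6 : 'd (fun u => cexp (- L u)) u 1 = cexp (- L u) * - mu u.
    by apply: (etrans E2); congr (_ * _).
  have E7 : 'd D u 1 = a u * (cexp (- L u) * - mu u) +
      cexp (- L u) * partial_derivative A (u, e).
    by apply: (etrans E1); congr (_ * _ + _ * _).
  apply: (etrans E7); rewrite /mu /m; have := An0 (u, e) Ue.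
  rewrite -/(a u); move: (a u) (partial_derivative A (u, e)).
  by move: (cexp _) => c x y x0; field.
have L0 : L 0 = 0 by rewrite LE mul0r.
have := derive_zero_cst dD z; rewrite /D a1 mul1r L0 oppr0 cexp0 => Dz.
rewrite -/(a z) -LE.
have := cexpN (L z) => cL.
by rewrite -[LHS]mulr1 -cL mulrCA Dz mulr1.
Qed.

(** The Cauchy integral over the unit circle [F1] of [F (_, e)] is holomorphic in
    [(z, e)] for [nrm z < 1].  It agrees with [F] when [e] is in [V], where 0 is a
    removable singularity, hence for all [e] by density and continuity. *)
Lemma extension_across_zero (F : C * E -> C) (V : set E) :
  (forall p, p.1 != 0 -> U p.2 -> differentiable F p) ->
  (forall e, U e -> forall d : R, 0 < d -> exists e', [/\ U e', V e' & nrm (e' - e) < d]) ->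
  (forall e, U e -> V e -> exists d M : R,
     0 < d /\ forall u : C, 0 < nrm u < d -> nrm (F (u, e)) <= M) ->
  exists2 F' : C * E -> C, (forall p, U p.2 -> differentiable F' p) &
    forall p, p.1 != 0 -> U p.2 -> F' p = F p.
Proof.
move=> dF dense bF.
pose F1 (p : C * E) := segment_integral
  (fun t => F (circle t, p.2) * (circle t / (circle t - p.1))).
have dF1 p : nrm p.1 < 1 -> U p.2 -> differentiable F1 p.
  move=> p1 Up; pose G (q : C * (C * E)) :=
    F (circle q.1, q.2.2) * (circle q.1 / (circle q.1 - q.2.1)).
  apply: (@segment_integral_differentiable R _ G) => t It.
  have db (q : C * (C * E)) :
      differentiable (fun q : C * (C * E) => circle q.1 - q.2.1) q.
    by apply: diffableB; [exact: dc|exact: d1].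
  have nU : \forall q \near (t, p), U q.2.2 by apply: (near_comp (P := U) (d2 _)); exact: near_U.
  have nb : \forall q \near (t, p), circle q.1 - q.2.1 != 0.
    apply: near_neq0; first exact: db.
    rewrite /= subr_eq0; apply: contraTneq p1 => <-.
    by rewrite nrm_circle// ltxx.
  apply: filterS2 nU nb => q Uq q0; apply: diffableM.
    apply: (@diffable_comp _ _ q _ _ (fun q : C * (C * E) => (circle q.1, q.2.2)) F).
      by apply: diffable_pair; [exact: dc|exact: d2].
    by apply: dF => //; exact: circle_neq0.
  by apply: diffableM; [exact: dc|apply: diffableV; [exact: db|exact: q0]].
have dslice (B : C * E -> C) z e : differentiable B (z, e) ->
    {for e, continuous (fun e => B (z, e))}.
  move=> dB; apply: differentiable_continuous.
  apply: (@diffable_comp _ _ _ _ _ (fun e : E => (z, e)) B); last exact: dB.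
  by apply: diffable_pair; [exact: diffable_cst|exact: diffable_id].
have F1V z e : z != 0 -> nrm z < 1 -> U e -> V e -> F (z, e) = F1 (z, e).
  move=> z0 z1 Ue Ve.
  have dFe u : 0 < nrm u < 2 -> differentiable (fun u : C => F (u, e)) u.
    move=> /andP[u0 _].
    apply: (@diffable_comp _ _ _ _ _ (fun u : C => (u, e)) F).
      by apply: diffable_pair; [exact: diffable_id|exact: diffable_cst].
    by apply: dF; rewrite //= -nrm_gt0.
  rewrite (cauchy_formula_punctured dFe (bF e Ue Ve) z0 z1 (ltr1n R 2)).
  by apply: segment_integral_ext => t _; rewrite rmorph1 mul1r.
have F1U z e : z != 0 -> nrm z < 1 -> U e -> F (z, e) = F1 (z, e).
  move=> z0 z1 Ue; apply/eqP; rewrite -subr_eq0; apply/eqP/nrm_small => x x0.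
  have x2 : 0 < x / 2 by rewrite divr_gt0.
  have dFp : differentiable F (z, e) by exact: dF.
  have dF1p : differentiable F1 (z, e) by exact: dF1.
  have /continuous_nrmP/(_ _ x2)[d d0 hd] := dslice F z e dFp.
  have /continuous_nrmP/(_ _ x2)[d' d'0 hd'] := dslice F1 z e dF1p.
  have mn : 0 < Num.min d d' by rewrite lt_min d0.
  have [e' [Ue' Ve']] := dense e Ue _ mn; rewrite lt_min => /andP[h1 h2].
  apply: (le_trans (nrm_dist _ _ (F (z, e')))).
  rewrite [x]splitr; apply: lerD; first by rewrite nrm_distC ltW// hd.
  by rewrite F1V// ltW// hd'.
(* Near [z = 0] this function is [F1], elsewhere it is locally [F]. *)
exists (fun p => if p.1 == 0 then F1 p else F p); last by move=> p /negbTE ->.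
move=> [z e] /= Ue; have [z0|z0] := eqVneq z 0.
  apply: (@differentiable_near_eq _ _ _ F1); last by apply: dF1; rewrite //= z0 nrm0.
  have nU : \forall q \near (z, e), U q.2.
    by apply: (near_comp (P := U) (diffable_snd _)); exact: near_U.
  have n1 : \forall q \near (z, e), nrm q.1 < 1.
    apply: (near_comp (P := fun u : C => nrm u < 1) (diffable_fst _)).
    by apply/nbhs_nrmP; exists 1 => // y /=; rewrite z0 subr0.
  apply: filterS2 nU n1 => -[u f] /= Uf u1.
  by case: eqP => // /eqP u0; rewrite F1U.
apply: (@differentiable_near_eq _ _ _ F); last exact: dF.
have : \forall q \near (z, e), q.1 != 0 by apply: near_neq0; [exact: diffable_fst|].
by apply: filterS => q /negbTE ->.
Qed.

End HolomorphicFamilies.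

(** * The spectral ball and its fibres *)

Section SpectralBall.
Context (R : realType).
Local Notation C := (Cx R).
Local Notation M2 := 'M[C]_2.

Definition mx22 (a b c d : C) : M2 :=
  a *: delta_mx 0 0 + b *: delta_mx 0 1 + (c *: delta_mx 1 0 + d *: delta_mx 1 1).

Lemma mx22E a b c d :
  (mx22 a b c d 0 0 = a) * (mx22 a b c d 0 1 = b) *
  (mx22 a b c d 1 0 = c) * (mx22 a b c d 1 1 = d).
Proof. by rewrite /mx22 !mxE /= !(mulr1, mulr0, addr0, add0r). Qed.

Let e00 a b c d : mx22 a b c d 0 0 = a. Proof. by rewrite mx22E. Qed.
Let e01 a b c d : mx22 a b c d 0 1 = b. Proof. by rewrite mx22E. Qed.
Let e10 a b c d : mx22 a b c d 1 0 = c. Proof. by rewrite mx22E. Qed.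
Let e11 a b c d : mx22 a b c d 1 1 = d. Proof. by rewrite mx22E. Qed.

Lemma ord2 (i : 'I_2) : i = 0 \/ i = 1.
Proof. by case: i => -[|[|//]] H; [left|right]; apply: val_inj. Qed.

Lemma mx2P (x y : M2) : x 0 0 = y 0 0 -> x 0 1 = y 0 1 -> x 1 0 = y 1 0 ->
  x 1 1 = y 1 1 -> x = y.
Proof.
move=> h1 h2 h3 h4; apply/matrixP => i j.
by case: (ord2 i) => ->; case: (ord2 j) => ->.
Qed.

Lemma mx22_eta (x : M2) : x = mx22 (x 0 0) (x 0 1) (x 1 0) (x 1 1).
Proof. by apply: mx2P; rewrite mx22E. Qed.

Lemma tr2 (x : M2) : \tr x = x 0 0 + x 1 1.
Proof.
rewrite /mxtrace !big_ord_recl big_ord0 addr0; congr (x _ _ + x _ _); exact: val_inj.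
Qed.

Lemma det2 (x : M2) : \det x = x 0 0 * x 1 1 - x 0 1 * x 1 0.
Proof.
rewrite (expand_det_row _ ord0) !big_ord_recl big_ord0 addr0 /cofactor !det_mx11 !mxE /=.
rewrite !expr0 expr1 mul1r mulN1r mulrN.
by congr (x _ _ * x _ _ - x _ _ * x _ _); exact: val_inj.
Qed.

Lemma mul_mx2 (x y : M2) i j : (x *m y) i j = x i 0 * y 0 j + x i 1 * y 1 j.
Proof.
rewrite mxE !big_ord_recl big_ord0 addr0.
by congr (x _ _ * y _ _ + x _ _ * y _ _); exact: val_inj.
Qed.

Lemma mul_mx22 a b c d a' b' c' d' : mx22 a b c d *m mx22 a' b' c' d' =
  mx22 (a * a' + b * c') (a * b' + b * d') (c * a' + d * c') (c * b' + d * d').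
Proof.
apply: mx2P; rewrite mul_mx2.
- apply: (etrans _ (esym (e00 _ _ _ _))).
  by congr (_ * _ + _ * _); [exact: e00|exact: e00|exact: e01|exact: e10].
- apply: (etrans _ (esym (e01 _ _ _ _))).
  by congr (_ * _ + _ * _); [exact: e00|exact: e01|exact: e01|exact: e11].
- apply: (etrans _ (esym (e10 _ _ _ _))).
  by congr (_ * _ + _ * _); [exact: e10|exact: e00|exact: e11|exact: e10].
- apply: (etrans _ (esym (e11 _ _ _ _))).
  by congr (_ * _ + _ * _); [exact: e10|exact: e01|exact: e11|exact: e11].
Qed.

Lemma eigenvalue2 (x : M2) l : eigenvalue x l = (l ^+ 2 - \tr x * l + \det x == 0).
Proof.
have -> : l ^+ 2 - \tr x * l + \det x = \det (x - l%:M).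
  by rewrite tr2 !det2 !mxE /= !mulr1n !mulr0n; ring.
apply/eigenvalueP/det0P => -[v h1 h2]; exists v => //.
  by rewrite mulmxBr h1 mul_mx_scalar subrr.
by apply/eqP; rewrite -subr_eq0 -mul_mx_scalar -mulmxBr h2.
Qed.

Lemma symmetrized_bidiscP (s p : C) : symmetrized_bidisc (s, p) <->
  exists l1 l2 : C, [/\ nrm l1 < 1, nrm l2 < 1, s = l1 + l2 & p = l1 * l2].
Proof.
have lt1 (l : C) : (`|l| < 1) = (nrm l < 1) by rewrite -rc_nrm -(rmorph1 (@rc R)) rc_lt.
split=> [[[l1 l2] /= [h1 h2] [<- <-]]|[l1 [l2 [h1 h2 -> ->]]]].
  by exists l1, l2; split; rewrite -?lt1.
by exists (l1, l2); rewrite //= !lt1.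
Qed.

(** The complex numbers are algebraically closed, here in the form of square
    roots. *)
Lemma quadratic_split (s p : C) : exists l1 l2 : C, s = l1 + l2 /\ p = l1 * l2.
Proof.
pose d := sqrtC (s ^+ 2 - 4 * p); have dE : d ^+ 2 = s ^+ 2 - 4 * p := sqrtCK _.
exists ((s + d) / 2), ((s - d) / 2); split; first by field.
have -> : (s + d) / 2 * ((s - d) / 2) = (s ^+ 2 - d ^+ 2) / 4 by field.
by rewrite dE; field.
Qed.

(** The eigenvalues are the roots of the characteristic polynomial. *)
Lemma spectral_ballP (x : M2) :
  spectral_ball x <-> symmetrized_bidisc (\tr x, \det x).
Proof.
have [l1 [l2 [sE pE]]] := quadratic_split (\tr x) (\det x).
have ev l : eigenvalue x l = (l == l1) || (l == l2).
  rewrite eigenvalue2 sE pE; have -> : l ^+ 2 - (l1 + l2) * l + l1 * l2 = (l - l1) * (l - l2).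
    by ring.
  by rewrite mulf_eq0 !subr_eq0.
set S := [set complex.Re `|l| | l in [set l : C | eigenvalue x l]].
have S1 : S (nrm l1) by exists l1; rewrite //= ev eqxx.
have S2 : S (nrm l2) by exists l2; rewrite //= ev eqxx orbT.
have ubS : ubound S (Num.max (nrm l1) (nrm l2)).
  by move=> _ [l /= + <-]; rewrite ev => /orP[]/eqP->; rewrite -/(nrm _) le_max lexx ?orbT.
split=> [h|].
  have lt1 l : S (nrm l) -> nrm l < 1.
    by move=> Sl; apply: le_lt_trans h; apply: ub_le_sup Sl; eexists; exact: ubS.
  by apply/symmetrized_bidiscP; exists l1, l2; split=> //; exact: lt1.
move=> /symmetrized_bidiscP[m1 [m2 [h1 h2 sm pm]]].
have mem (l : C) : (l == l1) || (l == l2) -> nrm l < 1.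
  rewrite -ev eigenvalue2 sm pm.
  have -> : l ^+ 2 - (m1 + m2) * l + m1 * m2 = (l - m1) * (l - m2) by ring.
  by rewrite mulf_eq0 !subr_eq0 => /orP[]/eqP->.
apply: (@le_lt_trans _ _ (Num.max (nrm l1) (nrm l2))).
  by apply: ge_sup ubS; exists (nrm l1).
by rewrite gt_max !mem// eqxx ?orbT.
Qed.

(** Let [l1], [l2] be the roots for [(s, p)] and [m] a root for [(s', p')] with
    [nrm m >= 1].  Then [(m - l1) * (m - l2) = (s' - s) * m - (p' - p)], whose
    left side has norm at least [(1 - nrm l1) * (1 - nrm l2) * nrm m ^ 2]; this is
    impossible when [(s', p')] is close to [(s, p)]. *)
Lemma open_symmetrized_bidisc : open (@symmetrized_bidisc R).
Proof.
rewrite openE => -[s p] /symmetrized_bidiscP[l1 [l2 [h1 h2 sE pE]]].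
suff : \forall e \near (s, p), symmetrized_bidisc e by [].
apply/nbhs_nrmP; set d := (1 - nrm l1) * (1 - nrm l2).
have d0 : 0 < d by rewrite mulr_gt0// subr_gt0.
exists (d / 2); first by rewrite divr_gt0.
move=> [s' p']; rewrite nrm_pair /= gt_max => /andP[hs hp].
apply/symmetrized_bidiscP; have [m1 [m2 [sm pm]]] := quadratic_split s' p'.
suff root (m : C) : m ^+ 2 - s' * m + p' = 0 -> nrm m < 1.
  exists m1, m2; split=> //; apply: root; rewrite sm pm; ring.
move=> m0; rewrite ltNge; apply/negP => m1'.
have eqm : (m - l1) * (m - l2) = (s' - s) * m - (p' - p).
  by apply/eqP; rewrite -subr_eq0; apply/eqP; rewrite -m0 sE pE; ring.
have b1 : nrm m - nrm l1 <= nrm (m - l1) by have := nrmD (m - l1) l1; rewrite subrK; lra.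
have b2 : nrm m - nrm l2 <= nrm (m - l2) by have := nrmD (m - l2) l2; rewrite subrK; lra.
have : nrm (m - l1) * nrm (m - l2) <= nrm (s' - s) * nrm m + nrm (p' - p).
  by rewrite -!nrmM eqm nrmB.
have := nrm_ge0 l1; have := nrm_ge0 l2.
move: (nrm (m - l1)) (nrm (m - l2)) (nrm (s' - s)) (nrm (p' - p)) b1 b2 hs hp.
rewrite /d in d0 *; move: (nrm m) (nrm l1) (nrm l2) m1' h1 h2 d0.
clear => M a b M1 a1 b1 d0 x y u v xa yb hu hv b0 a0 H.
have xa' : M * (1 - a) <= x by nra.
have yb' : M * (1 - b) <= y by nra.
have xy : M * (1 - a) * (M * (1 - b)) <= x * y.
  by apply: ler_pM => //; rewrite mulr_ge0//; lra.
have : u * M + v < (1 - a) * (1 - b) * (M * M).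
  set D := (1 - a) * (1 - b) in d0 hu hv *.
  have h1 : u * M <= D / 2 * M by rewrite ler_wpM2r//; lra.
  have h2 : D * M <= D * (M * M) by rewrite ler_wpM2l//; nra.
  have h3 : D / 2 <= D / 2 * M by rewrite ler_peMr//; lra.
  lra.
have -> : (1 - a) * (1 - b) * (M * M) = M * (1 - a) * (M * (1 - b)) by ring.
by lra.
Qed.

Lemma diffable_entry (i j : 'I_2) (x : M2) : differentiable (fun y : M2 => y i j : C) x.
Proof. exact: differentiable_coord. Qed.

Lemma diffable_mx22 (V : normedModType C) (a b c d : V -> C) v :
  differentiable a v -> differentiable b v -> differentiable c v -> differentiable d v ->
  differentiable (fun u => mx22 (a u) (b u) (c u) (d u)) v.
Proof.
move=> da db dc dd.
have dZ (f : V -> C) (x : M2) : differentiable f v -> differentiable (fun u => f u *: x) v.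
  by move=> df; exact: differentiableZl.
exact: (differentiableD (differentiableD (dZ _ _ da) (dZ _ _ db))
  (differentiableD (dZ _ _ dc) (dZ _ _ dd))).
Qed.

Lemma diffable_tr (x : M2) : differentiable (fun y : M2 => \tr y : C) x.
Proof.
have -> : (fun y : M2 => \tr y) = (fun y : M2 => y 0 0 + y 1 1).
  by apply/funext => y; exact: tr2.
exact: (diffableD (diffable_entry 0 0 x) (diffable_entry 1 1 x)).
Qed.

Lemma diffable_det (x : M2) : differentiable (fun y : M2 => \det y : C) x.
Proof.
have -> : (fun y : M2 => \det y) = (fun y : M2 => y 0 0 * y 1 1 - y 0 1 * y 1 0).
  by apply/funext => y; exact: det2.
exact: (diffableB (diffableM (diffable_entry 0 0 x) (diffable_entry 1 1 x))
  (diffableM (diffable_entry 0 1 x) (diffable_entry 1 0 x))).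
Qed.

(** Conjugation by a lower unipotent matrix preserves these three functions. *)
Definition invariants (x : M2) : C * (C * C) := (x 0 1, (\tr x, \det x)).

Lemma diffable_invariants (x : M2) : differentiable invariants x.
Proof.
exact: (diffable_pair (diffable_entry 0 1 x) (diffable_pair (diffable_tr x) (diffable_det x))).
Qed.

Lemma open_spectral_ball : open (@spectral_ball R).
Proof.
rewrite openE => x /spectral_ballP Bx.
have dtd := diffable_pair (diffable_tr x) (diffable_det x).
have N : \forall y \near x, symmetrized_bidisc (\tr y, \det y).
  apply: (differentiable_continuous dtd); apply: open_nbhs_nbhs.
  by split; [exact: open_symmetrized_bidisc|exact: Bx].
suff : \forall y \near x, spectral_ball y by [].
by apply: filterS N => y /spectral_ballP.
Qed.

Lemma lower_unipotentE (c : C) : lower_unipotent c = mx22 1 0 c 1.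
Proof.
by apply: mx2P; rewrite !mx22E /lower_unipotent !mxE /= ?(mulr0, mulr1, mulr1n, mulr0n, addr0, add0r).
Qed.

Lemma invmx_lower_unipotent (c : C) : invmx (lower_unipotent c) = lower_unipotent (- c).
Proof.
have LN : lower_unipotent c *m lower_unipotent (- c) = 1%:M.
  rewrite !lower_unipotentE mul_mx22 !(mul0r, mulr0, mul1r, mulr1, add0r, addr0) subrr.
  by apply: mx2P; rewrite mx22E mxE.
have uL : lower_unipotent c \in unitmx.
  by rewrite unitmxE lower_unipotentE det2 !mx22E mulr1 mul0r subr0 unitr1.
by rewrite -[RHS](mulKmx uL) LN mulmx1.
Qed.

Lemma shear_conjE (b : M2 -> C) x : shear_conj b x =
  mx22 (x 0 0 - b x * x 0 1) (x 0 1)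
       (x 1 0 + b x * x 0 0 - b x * (x 1 1 + b x * x 0 1)) (x 1 1 + b x * x 0 1).
Proof.
rewrite /shear_conj invmx_lower_unipotent !lower_unipotentE.
rewrite [X in _ *m X *m _]mx22_eta !mul_mx22; congr mx22; ring.
Qed.

Lemma shear_conj00 (b : M2 -> C) x : shear_conj b x 0 0 = x 0 0 - b x * x 0 1.
Proof. by rewrite shear_conjE mx22E. Qed.

Lemma shear_conj_invariants (b : M2 -> C) x :
  invariants (shear_conj b x) = invariants x.
Proof.
rewrite /invariants !tr2 !det2 shear_conjE !mx22E.
by congr (_, (_, _)); ring.
Qed.

(** Where [q.1 != 0], the fibre of [invariants] over [q] is a complex line, with
    the entry [w] in position (1, 1) as coordinate. *)
Definition fibre_point (w : C) (q : C * (C * C)) : M2 :=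
  mx22 w q.1 ((w * (q.2.1 - w) - q.2.2) / q.1) (q.2.1 - w).

Lemma fibre_point00 w q : fibre_point w q 0 0 = w.
Proof. by rewrite mx22E. Qed.

Lemma invariants_fibre_point w q : q.1 != 0 -> invariants (fibre_point w q) = q.
Proof.
case: q => z [s p] /= z0; rewrite /invariants tr2 det2 !mx22E /=.
by congr (_, (_, _)); field.
Qed.

Lemma fibre_point_invariants (x : M2) : x 0 1 != 0 -> fibre_point (x 0 0) (invariants x) = x.
Proof.
move=> x0; apply: mx2P; rewrite !mx22E /= ?tr2 ?det2 //; last by ring.
by field.
Qed.

Lemma fibre_point_ball w q : q.1 != 0 -> symmetrized_bidisc q.2 ->
  spectral_ball (fibre_point w q).
Proof.
case: q => z [s p] q0 hq; apply/spectral_ballP.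
by have [_ -> ->] := invariants_fibre_point w q0.
Qed.

Lemma diffable_fibre_point (V : normedModType C) (w : V -> C) (q : V -> C * (C * C)) v :
  differentiable w v -> differentiable q v -> (q v).1 != 0 ->
  differentiable (fun u => fibre_point (w u) (q u)) v.
Proof.
move=> dw dq q0.
have d1 := diffable_comp dq (diffable_fst (q v)).
have d2 := diffable_comp dq (diffable_snd (q v)).
have ds := diffable_comp d2 (diffable_fst (q v).2).
have dp := diffable_comp d2 (diffable_snd (q v).2).
apply: diffable_mx22; [exact: dw|exact: d1| |exact: (diffableB ds dw)].
exact: (diffableM (diffableB (diffableM dw (diffableB ds dw)) dp) (diffableV d1 q0)).
Qed.

End SpectralBall.

(** * Shears that are automorphisms of the spectral ball *)

Section ShearAutomorphism.
Context (R : realType).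
Local Notation C := (Cx R).
Local Notation M2 := 'M[C]_2.
Variable b : M2 -> C.
Hypothesis hb : holomorphic_on (@spectral_ball R) b.
Hypothesis hT : automorphism_of (@spectral_ball R) (shear_conj b).

Local Notation G2 := (@symmetrized_bidisc R).

(** The coefficients of [b], which will turn out to be affine in [w] on the
    fibres. *)
Definition fibre_intercept (q : C * (C * C)) : C := b (fibre_point 0 q).
Definition fibre_slope (q : C * (C * C)) : C :=
  b (fibre_point 1 q) - b (fibre_point 0 q).

Lemma diffable_b_fibre_point (V : normedModType C) (w : V -> C) (q : V -> C * (C * C)) v :
  differentiable w v -> differentiable q v -> (q v).1 != 0 -> G2 (q v).2 ->
  differentiable (fun u => b (fibre_point (w u) (q u))) v.
Proof.
move=> dw dq q0 Gq; apply: (diffable_comp (diffable_fibre_point dw dq q0)).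
by apply: hb; exact: fibre_point_ball.
Qed.

Lemma shear_fibre_point w q : q.1 != 0 ->
  shear_conj b (fibre_point w q) = fibre_point (w - b (fibre_point w q) * q.1) q.
Proof.
move=> q0.
have E : invariants (shear_conj b (fibre_point w q)) = q.
  by rewrite shear_conj_invariants invariants_fibre_point.
have E1 : shear_conj b (fibre_point w q) 0 1 = q.1 by rewrite -[in RHS]E.
have E0 : shear_conj b (fibre_point w q) 0 0 = w - b (fibre_point w q) * q.1.
  by rewrite shear_conj00 fibre_point00 mx22E.
by rewrite -[LHS]fibre_point_invariants ?E1// E E0.
Qed.

(** In the coordinate [w] the shear acts on the fibre over [q] by the entire map
    [f w = w - q.1 * b], and its inverse acts by an entire map too.  So [f] is
    affine, and its linear coefficient [1 - q.1 * fibre_slope q] is not zero. *)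
Lemma b_affine_on_fibres w q : q.1 != 0 -> G2 q.2 ->
  b (fibre_point w q) = fibre_intercept q + w * fibre_slope q /\
  1 - q.1 * fibre_slope q != 0.
Proof.
move=> q0 Gq; case: hT => _ _ [g [dg gB gT Tg]].
have inB u : spectral_ball (fibre_point u q) by exact: fibre_point_ball.
pose f u := u - b (fibre_point u q) * q.1.
pose k u := g (fibre_point u q) 0 0.
have gE u : g (fibre_point u q) = fibre_point (k u) q.
  have E : invariants (g (fibre_point u q)) = q.
    by rewrite -(shear_conj_invariants b) Tg// invariants_fibre_point.
  have E1 : g (fibre_point u q) 0 1 = q.1 by rewrite -[in RHS]E.
  by rewrite -[LHS]fibre_point_invariants ?E1// E.
have fk : cancel f k.
  move=> u; have H := gT _ (inB u); rewrite shear_fibre_point// -/(f u) in H.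
  by rewrite /k H fibre_point00.
have kf : cancel k f.
  move=> u; have := Tg _ (inB u); rewrite gE shear_fibre_point// -/(f (k u)).
  by move=> /(congr1 (fun x : M2 => x 0 0)); rewrite !fibre_point00.
have dpt u : differentiable (fun u : C => fibre_point u q) u.
  apply: diffable_fibre_point; [exact: diffable_id|exact: diffable_cst|exact: q0].
have df u : differentiable f u.
  apply: diffableB; first exact: diffable_id.
  apply: diffableM; last exact: diffable_cst.
  exact: (diffable_comp (dpt u) (hb (inB u))).
have dk u : differentiable k u.
  exact: (diffable_comp (diffable_comp (dpt u) (dg _ (inB u))) (diffable_entry 0 0 _)).
have aff := entire_automorphism_affine df dk fk kf.
split.
  have cancel (x y z t : C) : t != 0 -> w - x * t = 0 - y * t + w * (1 - z * t - (0 - y * t)) ->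
      x = y + w * (z - y).
    move=> t0 H; apply: (mulIf t0); apply/eqP; rewrite -subr_eq0; apply/eqP.
    have -> : x * t - (y + w * (z - y)) * t =
      (0 - y * t + w * (1 - z * t - (0 - y * t))) - (w - x * t) by ring.
    by rewrite H subrr.
  exact: cancel q0 (aff w).
have -> : 1 - q.1 * fibre_slope q = f 1 - f 0.
  have expand (x y t : C) : 1 - t * (x - y) = 1 - x * t - (0 - y * t) by ring.
  exact: expand.
by rewrite subr_eq0; apply/eqP => /(can_inj fk)/eqP; rewrite oner_eq0.
Qed.

Lemma diffable_intercept q : q.1 != 0 -> G2 q.2 -> differentiable fibre_intercept q.
Proof.
move=> q0 Gq.
exact: (diffable_b_fibre_point (diffable_cst _ _) (diffable_id _) q0 Gq).
Qed.

Lemma diffable_slope q : q.1 != 0 -> G2 q.2 -> differentiable fibre_slope q.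
Proof.
move=> q0 Gq; apply: diffableB;
  exact: (diffable_b_fibre_point (diffable_cst _ _) (diffable_id _) q0 Gq).
Qed.

(** The discriminant of [t ^ 2 - e.1 * t + e.2] is not zero. *)
Definition distinct_roots : set (C * C) := [set e | e.1 ^+ 2 != 4 * e.2].

Lemma distinct_roots_dense e : G2 e -> forall d : R, 0 < d ->
  exists e', [/\ G2 e', distinct_roots e' & nrm (e' - e) < d].
Proof.
move=> Ge d d0; have [De|/negP/negPn/eqP De] := pselect (distinct_roots e).
  by exists e; rewrite subrr nrm0.
have /nbhs_nrmP[d' d'0 hd'] : \forall e' \near e, G2 e'.
  by apply: open_nbhs_nbhs; split; [exact: open_symmetrized_bidisc|].
pose x := Num.min d d' / 2.
have x0 : 0 < x by rewrite divr_gt0// lt_min d0.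
have xd : x < Num.min d d' by rewrite /x ltr_pdivrMr// ltr_pMr ?ltr1n// lt_min d0.
have E : nrm ((e.1, e.2 + rc x) - e) = x.
  rewrite nrm_pair /= subrr nrm0 addrC addKr nrm_rc gtr0_norm//.
  by apply/max_idPr/ltW.
move: xd; rewrite lt_min => /andP[xd xd'].
exists (e.1, e.2 + rc x); split; rewrite ?E//; first by apply: hd'; rewrite E.
rewrite /distinct_roots /= De mulrDr -subr_eq0 opprD addrA subrr sub0r oppr_eq0.
by rewrite mulf_neq0 ?pnatr_eq0// -nrm_eq0 nrm_rc gt_eqF// normr_gt0 gt_eqF.
Qed.

(** The upper triangular matrices with diagonal [(l1, l2)] and corner [u] are the
    points with coordinate [l1] of the fibres over [(u, (l1 + l2, l1 * l2))].
    They converge to a point of the spectral ball as [u] tends to 0, and [b] is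
    bounded near that point. *)
Lemma b_bounded_on_diagonal (l1 l2 : C) : G2 (l1 + l2, l1 * l2) ->
  exists d M : R, 0 < d /\ forall u : C, 0 < nrm u < d ->
    nrm (fibre_intercept (u, (l1 + l2, l1 * l2)) +
         l1 * fibre_slope (u, (l1 + l2, l1 * l2))) <= M.
Proof.
move=> Gl; pose y u := mx22 l1 u 0 l2.
have y0 : spectral_ball (y 0).
  by apply/spectral_ballP; rewrite tr2 det2 !mx22E mul0r subr0.
have cy : {for 0, continuous (fun u => b (y u))}.
  apply: differentiable_continuous; apply: (diffable_comp _ (hb y0)).
  by apply: diffable_mx22;
    [exact: diffable_cst|exact: diffable_id|exact: diffable_cst|exact: diffable_cst].
have /continuous_nrmP/(_ 1 ltr01)[d d0 hd] := cy.
exists d, (1 + nrm (b (y 0))); split=> // u /andP[u0 ud].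
have un0 : u != 0 by rewrite -nrm_gt0.
have [<- _] := @b_affine_on_fibres l1 (u, (l1 + l2, l1 * l2)) un0 Gl.
have -> : fibre_point l1 (u, (l1 + l2, l1 * l2)) = y u.
  by rewrite /fibre_point /y /=; congr mx22; [field|ring].
have -> : b (y u) = (b (y u) - b (y 0)) + b (y 0) by rewrite subrK.
by apply: (le_trans (nrmD _ _)); rewrite lerD2r ltW// hd// subr0.
Qed.

(** When [l1 != l2], the slope and the intercept are determined by the values of
    [b] at the two points of the fibre with coordinates [l1] and [l2], both of
    which stay bounded. *)
Lemma slope_intercept_bounded e : G2 e -> distinct_roots e ->
  (exists d M : R, 0 < d /\ forall u : C, 0 < nrm u < d ->
     nrm (fibre_slope (u, e)) <= M) /\
  (exists d M : R, 0 < d /\ forall u : C, 0 < nrm u < d ->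
     nrm (fibre_intercept (u, e)) <= M).
Proof.
case: e => s p Ge; have /symmetrized_bidiscP[l1 [l2 [_ _ sE pE]]] := Ge.
rewrite {}sE {}pE in Ge *; rewrite /distinct_roots /= => De.
have l12 : l1 - l2 != 0.
  apply: contraNneq De => l0; rewrite -subr_eq0.
  have -> : (l1 + l2) ^+ 2 - 4 * (l1 * l2) = (l1 - l2) ^+ 2 by ring.
  by rewrite l0 expr0n.
have [d1 [M1 [d10 h1]]] := b_bounded_on_diagonal Ge.
have Ge' : G2 (l2 + l1, l2 * l1) by rewrite addrC mulrC.
have := b_bounded_on_diagonal Ge'; rewrite [l2 + l1]addrC [l2 * l1]mulrC.
move=> [d2 [M2' [d20 h2]]].
set e := (l1 + l2, l1 * l2) in h1 h2 *.
have slope u : 0 < nrm u < Num.min d1 d2 ->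
    nrm (fibre_slope (u, e)) <= (M1 + M2') / nrm (l1 - l2).
  move=> /andP[u0]; rewrite lt_min => /andP[u1 u2].
  have H1 : nrm _ <= M1 := h1 u _; have H2 : nrm _ <= M2' := h2 u _.
  rewrite u0 u1 in H1; rewrite u0 u2 in H2.
  have {}H1 := H1 isT; have {}H2 := H2 isT.
  rewrite ler_pdivlMr ?nrm_gt0// -nrmM.
  have -> : fibre_slope (u, e) * (l1 - l2) =
    (fibre_intercept (u, e) + l1 * fibre_slope (u, e)) -
    (fibre_intercept (u, e) + l2 * fibre_slope (u, e)).
    by move: (fibre_slope _) (fibre_intercept _) => x y; ring.
  by apply: (le_trans (nrmB _ _)); apply: lerD.
have d0 : 0 < Num.min d1 d2 by rewrite lt_min d10.
split; first by exists (Num.min d1 d2), ((M1 + M2') / nrm (l1 - l2)).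
exists (Num.min d1 d2), (M1 + nrm l1 * ((M1 + M2') / nrm (l1 - l2))); split=> // u hu.
have hs := slope u hu; move: hu => /andP[u0]; rewrite lt_min => /andP[u1 u2].
have -> : fibre_intercept (u, e) =
  (fibre_intercept (u, e) + l1 * fibre_slope (u, e)) - l1 * fibre_slope (u, e).
  by rewrite addrK.
apply: (le_trans (nrmB _ _)); apply: lerD; first by apply: h1; rewrite u0.
by rewrite nrmM ler_wpM2l ?nrm_ge0.
Qed.

End ShearAutomorphism.

(* The function q is the holomorphic extension across x_12 = 0 of the quotient
   in the formula; its values on the locus x_12 = 0 are determined by
   continuity. *)
Theorem mainTheorem5 (R : realType) (b : 'M[Cx R]_2 -> Cx R)
    (hb : holomorphic_on (@spectral_ball R) b)
    (hT : automorphism_of (@spectral_ball R) (shear_conj b)) :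
  exists alpha beta : Cx R * (Cx R * Cx R) -> Cx R,
    [/\ holomorphic_on ([set: Cx R] `*` @symmetrized_bidisc R) alpha,
        holomorphic_on ([set: Cx R] `*` @symmetrized_bidisc R) beta &
        exists q : 'M[Cx R]_2 -> Cx R,
          [/\ holomorphic_on (@spectral_ball R) q,
              (forall x : 'M[Cx R]_2, spectral_ball x -> x 0 1 != 0 ->
                 q x = (1 - cexp (x 0 1 * alpha (x 0 1, (\tr x, \det x))))
                       / x 0 1) &
              (forall x : 'M[Cx R]_2, spectral_ball x ->
                 b x = x 0 0 * q x + beta (x 0 1, (\tr x, \det x)))]].
Proof.
have oG := @open_symmetrized_bidisc R.
have bounded := slope_intercept_bounded hb hT.
have [slope dslope slopeE] := extension_across_zero oG
  (diffable_slope hb) (@distinct_roots_dense R)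
  (fun e Ge De => proj1 (bounded e Ge De)).
have [beta dbeta betaE] := extension_across_zero oG
  (diffable_intercept hb) (@distinct_roots_dense R)
  (fun e Ge De => proj2 (bounded e Ge De)).
pose A (p : Cx R * (Cx R * Cx R)) := 1 - p.1 * slope p.
have dA p : symmetrized_bidisc p.2 -> differentiable A p.
  move=> Gp; apply: diffableB; first exact: diffable_cst.
  by apply: diffableM; [exact: diffable_fst|exact: dslope].
have A_neq0 p : symmetrized_bidisc p.2 -> A p != 0.
  move=> Gp; rewrite /A; have [->|p0] := eqVneq p.1 0.
    by rewrite mul0r subr0 oner_eq0.
  by rewrite slopeE//; have [] := b_affine_on_fibres hb hT 0 p0 Gp.
have A1 e : symmetrized_bidisc e -> A (0, e) = 1.
  by rewrite /A mul0r subr0.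
have [alpha dalpha alphaE] := holomorphic_logarithm oG dA A_neq0 A1.
have ballG (x : 'M[Cx R]_2) : spectral_ball x -> symmetrized_bidisc (invariants x).2.
  by move=> /spectral_ballP.
pose q (x : 'M[Cx R]_2) := slope (invariants x).
have dq (x : 'M[Cx R]_2) : spectral_ball x -> differentiable q x.
  by move=> Bx; exact: (diffable_comp (diffable_invariants x) (dslope _ (ballG _ Bx))).
exists alpha, beta; split.
- by move=> p [_ Gp]; exact: dalpha.
- by move=> p [_ Gp]; exact: dbeta.
exists q; split; first exact: dq.
  move=> x Bx x0; have := alphaE (invariants x) (ballG x Bx).
  rewrite /A /q /= => <-.
  by rewrite subKr mulrAC divff// mul1r.
have off (x : 'M[Cx R]_2) : spectral_ball x -> x 0 1 != 0 ->
    b x = x 0 0 * q x + beta (invariants x).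
  move=> Bx x0; rewrite /q slopeE ?betaE//; try exact: ballG.
  rewrite addrC -{1}(fibre_point_invariants x0).
  by have [-> _] := b_affine_on_fibres hb hT (x 0 0) (q := invariants x) x0 (ballG _ Bx).
move=> x Bx; have [x0|x0] := eqVneq (x 0 1) 0; last exact: off.
pose D y := b y - (y 0 0 * q y + beta (invariants y)).
have cD : {for x, continuous D}.
  apply: differentiable_continuous; apply: diffableB; first exact: hb.
  apply: diffableD.
    by apply: diffableM; [exact: diffable_entry|exact: dq].
  exact: (diffable_comp (diffable_invariants x) (dbeta _ (ballG _ Bx))).
apply/eqP; rewrite -subr_eq0; apply/eqP; rewrite -[LHS]/(D x).
apply: nrm_small => e e0.
have /continuous_nrmP/(_ _ e0)[d d0 hd] := cD.
have /nbhs_nrmP[d' d'0 hd'] : \forall y \near x, spectral_ball y.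
  by apply: open_nbhs_nbhs; split; [exact: open_spectral_ball|].
set N := nrm (delta_mx 0 1 : 'M[Cx R]_2).
have N0 : 0 <= N := nrm_ge0 _.
(* Perturb the (1, 2) entry of [x] and conclude by continuity of [D]. *)
pose t := Num.min d d' / (N + 1) / 2.
have mn : 0 < Num.min d d' by rewrite lt_min d0.
have N1 : 0 < N + 1 by lra.
have t0 : 0 < t by rewrite !divr_gt0.
pose y : 'M[Cx R]_2 := x + rc t *: delta_mx 0 1.
have yx : nrm (y - x) < Num.min d d'.
  rewrite /y [x + _]addrC addrK nrmZ nrm_rc gtr0_norm// -/N /t.
  set m := Num.min d d' in mn *.
  have : m / (N + 1) * (N + 1) = m by rewrite divfK// gt_eqF.
  by have := divr_gt0 mn N1; set z := m / (N + 1) => z0 zE; rewrite -zE; nra.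
move: yx; rewrite lt_min => /andP[yd yd'].
have y0 : y 0 1 != 0.
  by rewrite /y !mxE x0 add0r /= mulr1 -nrm_eq0 nrm_rc gt_eqF// gtr0_norm.
have Dy : D y = 0 by rewrite /D (off y (hd' y yd') y0) subrr.
by have := hd y yd; rewrite Dy sub0r nrmN => /ltW.
Qed.
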